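(* Let $(\mathbb{X},d_{\mathbb{X}})$ be a Polish metric space with bounded diameter. For $P_1,P_2\in\mathcal{P}(\mathbb{X})$ and $\alpha>0$, $$\mathcal{W}_{\mathcal{W}}\big(\mathrm{DP}(\alpha,P_1),\mathrm{DP}(\alpha,P_2)\big)=\mathcal{W}(P_1,P_2).$$
   Context: $\mathcal{P}(\mathbb{X})$ is the space of Borel probability measures on $\mathbb{X}$ with the weak topology, and $\mathcal{P}(\mathcal{P}(\mathbb{X}))$ the space of Borel probability measures on it. $\mathcal{W}$ is the Wasserstein distance of order 1 on $\mathcal{P}(\mathbb{X})$: $\mathcal{W}(P_1,P_2)=\inf_{\gamma\in\Gamma(P_1,P_2)}\mathbb{E}_{(Z_1,Z_2)\sim\gamma}(d_{\mathbb{X}}(Z_1,Z_2))$, with $\Gamma$ the set of couplings. The Wasserstein over Wasserstein distance on $\mathcal{P}(\mathcal{P}(\mathbb{X}))$ is $\mathcal{W}_{\mathcal{W}}(\mathbb{Q}_1,\mathbb{Q}_2)=\inf_{\gamma\in\Gamma(\mathbb{Q}_1,\mathbb{Q}_2)}\mathbb{E}_{(\tilde P_1,\tilde P_2)\sim\gamma}(\mathcal{W}(\tilde P_1,\tilde P_2))$. Dirichlet process: $\mathrm{DP}(\alpha,P_0)$ is the law of the random probability $\sum_{i\ge1}J_i\delta_{X_i}$, where $X_i$ are i.i.d. with law $P_0$, independent of $V_i$ i.i.d. $\mathrm{Beta}(1,\alpha)$, and $J_i=V_i\prod_{j=1}^{i-1}(1-V_j)$. *)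

(* Defs.v *)
From HB Require Import structures.
From mathcomp Require Import all_boot all_order all_algebra.
From mathcomp Require Import all_classical all_reals all_analysis.

Set Implicit Arguments.
Unset Strict Implicit.
Unset Printing Implicit Defensive.

Import Order.TTheory GRing.Theory Num.Theory.
Import numFieldNormedType.Exports.

Local Open Scope classical_set_scope.
Local Open Scope ring_scope.

(* As everywhere in the library, complete spaces are pointed.  This loses no
   generality here: a space carrying a probability measure is not empty. *)
#[short(type="completeMetricType")]
HB.structure Definition CompleteMetric (R : numDomainType) :=
  {T of CompletePseudoMetric R T & PseudoMetric_isMetric R T}.

(* A Polish metric space is a separable completeMetricType. *)
Definition separable (T : topologicalType) : Prop :=
  exists2 A : set T, countable A & dense A.

Definition bounded_diameter (R : realType) (X : metricType R) : Prop :=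
  exists M : R, forall x y : X, mdist x y <= M.

Notation borelType T := (g_sigma_algebraType (@open T)).

Section spaces_of_probabilities.
Context {R : realType}.

Definition Cb (X : topologicalType) : Type :=
  {f : X -> R | continuous f /\ exists M, forall x, `|f x| <= M}.

Definition Cb_integral (X : ptopologicalType)
    (mu : probability (borelType X) R) : prod_topology (fun _ : Cb X => R) :=
  fun f => (\int[mu]_x sval f x)%R.

(* P(X) with the weak topology: the coarsest topology that makes
   mu |-> \int f dmu continuous for every bounded continuous f.

   A [probability] is a function on all subsets, so two elements of this type
   may agree on all Borel sets and differ elsewhere.  Such elements are
   topologically indistinguishable, hence lie in the same Borel sets of P(X),
   and nothing below distinguishes them. *)
Definition weakP (X : ptopologicalType) : ptopologicalType :=
  initial_topology (@Cb_integral X).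

End spaces_of_probabilities.

Arguments weakP R X : clear implicits.

Section wasserstein.
Context {R : realType}.
Local Open Scope ereal_scope.

Definition couplings d (T : measurableType d) (mu nu : probability T R) :
    set (probability (T * T)%type R) :=
  [set g | (forall A, measurable A -> g (A `*` setT) = mu A) /\
           (forall A, measurable A -> g (setT `*` A) = nu A)].

Definition transport_cost d (T : measurableType d) (c : T -> T -> \bar R)
    (mu nu : probability T R) : \bar R :=
  ereal_inf [set \int[g]_z c z.1 z.2 | g in couplings mu nu].

Definition W (X : completeMetricType R)
    (P1 P2 : probability (borelType X) R) : \bar R :=
  @transport_cost _ (borelType X) (fun x y => (mdist (x : X) y)%:E) P1 P2.

Definition WW (X : completeMetricType R)
    (Q1 Q2 : probability (borelType (weakP R X)) R) : \bar R :=
  @transport_cost _ (borelType (weakP R X)) (@W X) Q1 Q2.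

End wasserstein.

Section dirichlet_process.
Context {R : realType}.
Local Open Scope ereal_scope.

Definition euler_beta (a b : R) : R :=
  (\int[lebesgue_measure]_(x in `]0%R, 1%R[) (x `^ (a - 1) * (1 - x) `^ (b - 1)))%R.

(* The library's [beta_prob] only covers integer parameters. *)
Definition beta_law (a b : R) (A : set R) : \bar R :=
  \int[lebesgue_measure]_(x in A `&` `]0%R, 1%R[)
    (x `^ (a - 1) * (1 - x) `^ (b - 1) / euler_beta a b)%:E.

Section random_sequences.
Context d (Omega : measurableType d) (Pr : probability Omega R).

Definition mutually_independent d' (T : measurableType d')
    (Z : nat -> {RV Pr >-> T}) : Prop :=
  forall (s : seq nat) (B : nat -> set T),
    uniq s -> (forall i, measurable (B i)) ->
    Pr (\bigcap_(i in [set` s]) (Z i @^-1` B i)) =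
    \prod_(i <- s) Pr (Z i @^-1` B i).

Definition iid d' (T : measurableType d') (Z : nat -> {RV Pr >-> T})
    (mu : set T -> \bar R) : Prop :=
  (forall i A, measurable A -> distribution Pr (Z i) A = mu A) /\
  mutually_independent Z.

Definition sigma_seq d' (T : measurableType d') (Z : nat -> {RV Pr >-> T}) :
    set (set Omega) :=
  <<s \bigcup_i preimage_set_system setT (Z i) measurable >>.

Definition independent_seqs d1 d2 (T1 : measurableType d1)
    (T2 : measurableType d2) (Z1 : nat -> {RV Pr >-> T1})
    (Z2 : nat -> {RV Pr >-> T2}) : Prop :=
  forall A B, sigma_seq Z1 A -> sigma_seq Z2 B ->
    Pr (A `&` B) = Pr A * Pr B.

Definition stick (V : nat -> {RV Pr >-> R}) (i : nat) (w : Omega) : R :=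
  (V i w * \prod_(j < i) (1 - V j w))%R.

End random_sequences.

(* The weights sum to 1 only almost surely, hence the random probability p is
   required to equal the stick-breaking sum almost surely. *)
Definition is_DP (X : completeMetricType R) (alpha : R)
    (P : probability (borelType X) R)
    (Q : probability (borelType (weakP R X)) R) : Prop :=
  exists (d : measure_display) (Omega : measurableType d)
    (Pr : probability Omega R)
    (Z : nat -> {RV Pr >-> borelType X}) (V : nat -> {RV Pr >-> R})
    (p : {RV Pr >-> borelType (weakP R X)}),
    [/\ iid Z P,
        iid V (beta_law 1 alpha),
        independent_seqs Z V,
        {ae Pr, forall w, forall A : set (borelType X), measurable A ->
          (p w : probability (borelType X) R) A =
          \sum_(0 <= i <oo) (stick V i w)%:E * \d_(Z i w) A} &
        forall B, measurable B -> Q B = distribution Pr p B].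

(* [is_DP X alpha P] determines Q on all Borel sets; [get] picks it. *)
Definition DP (X : completeMetricType R) (alpha : R)
    (P : probability (borelType X) R) :
    probability (borelType (weakP R X)) R :=
  get [set Q | is_DP alpha P Q].

End dirichlet_process.

(* Main.v *)
Require Import Defs.
From HB Require Import structures.
From mathcomp Require Import all_boot all_order all_algebra.
From mathcomp Require Import all_classical all_reals all_analysis.
From mathcomp Require Import measurable_realfun ring lra.

Set Implicit Arguments.
Unset Strict Implicit.
Unset Printing Implicit Defensive.

Import Order.TTheory GRing.Theory Num.Theory.
Import numFieldNormedType.Exports.

Local Open Scope classical_set_scope.
Local Open Scope ring_scope.

(** Both inequalities compare the two Dirichlet processes through their
    stick-breaking series.

    Upper bound.  Let [g] be a coupling of [P1] and [P2].  Draw pairs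
    [(X_i, Y_i)] independently from [g] and break a single stick, so that
    [sum_i J_i delta_{X_i}] and [sum_i J_i delta_{Y_i}] share their weights:
    this is a coupling of the two Dirichlet processes.  Moving the mass [J_i]
    from [X_i] to [Y_i] costs [J_i * d(X_i, Y_i)], and the expectation of the
    sum is the cost of [g], because the weights sum to 1 and are independent of
    the pairs ([W_mixture], [expected_stick_series], [WW_le_W]).

    Lower bound.  By Kantorovich duality ([kantorovich]) there is a 1-Lipschitz
    function [f] with [W P1 P2 <= int f dP1 - int f dP2 + eps].  The potential
    [p |-> int f dp] is weakly continuous and 1-Lipschitz for [W], and its mean
    under the Dirichlet process with base measure [P] is [int f dP].  The easy
    half of duality, now on the space of probabilities, gives
    [int f dP1 - int f dP2 <= WW] ([transport_cost_ge], [WW_ge_potential]).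

    Four facts support this argument.

    - Infinite product measures exist.  The finite-dimensional masses define a
      set function on the algebra of cylinders; it is countably additive since
      decreasing cylinders with empty intersection have vanishing mass
      ([persistent_bigcap]), and Caratheodory extension applies.  This realizes
      the Dirichlet process, and since the joint law of the atoms and the sticks
      is determined by the finite boxes, all realizations have the same law
      ([is_DP_unique]).

    - A family of probabilities that depends measurably on a parameter in the
      sense of integrals of continuous functions is measurable for the Borel
      sets of the weak topology.  As the space is separable, this topology has a
      countable base, made of lower bounds on integrals of finite maxima of tent
      functions ([open_basic], [measurable_random_probability]).

    - The weights sum to 1 almost surely: the remaining length is a product of
      independent factors with a common law on the open unit interval
      ([proper_sticks_ae]).

    - Kantorovich duality on a separable space of bounded diameter reduces to
      finitely many points.  There it follows from the Hahn-Banach theorem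
      ([finite_duality]); an optimal finite plan lifts to a coupling, and the
      optimal prices extend to a Lipschitz function.

    The distance [W] is not shown to be measurable in its two arguments.  This
    causes no difficulty: the integral of a nonnegative function is the supremum
    of the integrals of the simple functions below it, and this lower integral
    is monotone and does not increase under transfer to an image law
    ([ge0_le_integralT], [integral_law_le]). *)

(** * Laws of random variables *)

Definition law d d' (T : measurableType d) (T' : measurableType d')
    (R : realType) (P : probability T R) (f : T -> T')
    (mf : measurable_fun setT f) : probability T' R :=
  distribution P (mfun_Sub (mem_set mf) : {mfun T >-> T'}).

Lemma lawE d d' (T : measurableType d) (T' : measurableType d')
    (R : realType) (P : probability T R) (f : T -> T')
    (mf : measurable_fun setT f) (A : set T') : law P mf A = P (f @^-1` A).
Proof. by []. Qed.

Lemma probability_eq_generator d (T : measurableType d) (R : realType)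
    (G : set (set T)) (P Q : probability T R) :
  measurable = <<s G >> -> setI_closed G -> (forall A, G A -> P A = Q A) ->
  forall A, measurable A -> P A = Q A.
Proof.
move=> GE GI PQ A mA.
pose g (_ : nat) := @setT T.
apply: (measure_unique (G `|` [set setT]) g) => //.
- rewrite GE; apply/seteqP; split; apply: smallest_sub => //.
  + by move=> X GX; apply: sub_sigma_algebra; left.
  + move=> X [GX|->]; first exact: sub_sigma_algebra.
    by rewrite -GE; exact: measurableT.
- move=> X Y [GX|->] [GY|->]; rewrite ?setIT ?setTI.
  + by left; apply: GI.
  + by left.
  + by left.
  + by right.
- by move=> n; right.
- by rewrite bigcup_const.
- move=> X [/PQ//|->]; transitivity (1%E : \bar R); first exact: probability_setT.
  by symmetry; exact: probability_setT.
- by move=> n; rewrite /g (_ : _ [set: T] = 1%E) ?ltry//; exact: probability_setT.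
Qed.

(** * Sequence spaces *)

Section sequence_space.
Context d (T : measurableType d).

Definition coord_sets : set (set (nat -> T)) :=
  \bigcup_i preimage_set_system setT (fun w => w i) measurable.

Definition seqspace := g_sigma_algebraType coord_sets.
HB.instance Definition _ := Measurable.on seqspace.

Lemma measurable_coord i : measurable_fun setT (fun w : seqspace => w i).
Proof.
move=> _ A mA; apply: sub_sigma_algebra; exists i => //.
by exists A.
Qed.

Lemma measurable_seqP d' (T' : measurableType d') (f : T' -> seqspace) :
  (forall i, measurable_fun setT (fun x => f x i)) -> measurable_fun setT f.
Proof.
move=> mf; apply: (@measurability _ _ T' seqspace setT f coord_sets) => //.
move=> _ [_ [i _ [A mA <-]] <-].
rewrite setTI preimage_setI preimage_setT setTI.
by rewrite -[X in measurable X]setTI; exact: (mf i).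
Qed.

Definition scons (u : T * seqspace) : seqspace :=
  fun n => if n is k.+1 then u.2 k else u.1.

Lemma measurable_scons : measurable_fun setT scons.
Proof.
apply: measurable_seqP => -[|i] /=; first exact: measurable_fst.
exact: measurableT_comp (measurable_coord i) measurable_snd.
Qed.

Definition slice (t : T) (A : set seqspace) : set seqspace :=
  [set w | A (scons (t, w))].

Lemma measurable_slice t A : measurable A -> measurable (slice t A).
Proof.
move=> mA; rewrite -[X in measurable X]setTI.
have := measurable_fun_pair2 t measurable_scons; exact.
Qed.

Definition prefix_determined n (A : set seqspace) : Prop :=
  forall w w', (forall i, (i < n)%N -> w i = w' i) -> A w -> A w'.

Lemma prefix_determined_slice n t A :
  prefix_determined n.+1 A -> prefix_determined n (slice t A).
Proof. by move=> nA w w' ww'; apply: nA => -[|i]// /ww'. Qed.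

Lemma prefix_determined_le m n A :
  (m <= n)%N -> prefix_determined m A -> prefix_determined n A.
Proof. by move=> mn mA w w' ww'; apply: mA => i im; apply/ww'/(leq_trans im). Qed.

End sequence_space.

(** * Infinite products of probabilities *)

Section product.
Context d (T : measurableType d) (R : realType) (mu : probability T R).
Local Notation Omega := (seqspace T).

(** The law of [n] independent coordinates of law [mu] followed by a constant
    tail.  These laws on the space of all sequences stand for the finite powers
    of [mu]: they agree on a set as soon as the first [n] coordinates determine
    that set. *)
Fixpoint iid_prefix n : probability Omega R :=
  if n is k.+1 then law (mu \x iid_prefix k)%E (@measurable_scons _ T)
  else dirac (point : Omega).

Lemma iid_prefixS n A : measurable A ->
  iid_prefix n.+1 A = (\int[mu]_t iid_prefix n (slice t A))%E.
Proof.
move=> mA; rewrite [LHS]lawE /=/product_measure1; apply: eq_integral => t _ /=.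
congr (iid_prefix n _); apply/seteqP; split => w; by rewrite /xsection/= inE.
Qed.

Lemma measurable_iid_prefix_slice n A : measurable A ->
  measurable_fun [set: T] (fun t => iid_prefix n (slice t A) : \bar R).
Proof.
move=> mA.
have mA' : measurable (@scons _ T @^-1` A).
  by rewrite -[X in measurable X]setTI; exact: measurable_scons.
have := measurable_fun_xsection (iid_prefix n) mA'.
apply: eq_measurable_fun => t _ /=.
congr (iid_prefix n _); apply/seteqP; split => w; by rewrite /xsection/= inE.
Qed.

Lemma iid_prefix_stableS n A : measurable A -> prefix_determined n A ->
  iid_prefix n.+1 A = iid_prefix n A.
Proof.
elim: n A => [|n IH] A mA nA.
  have [Ap|Ap] := pselect (A point).
    have -> : A = setT by apply/seteqP; split => // w _; apply: nA Ap.
    by rewrite !probability_setT.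
  have -> : A = set0 by apply/seteqP; split => // w Aw; apply: Ap; apply: nA Aw.
  by rewrite !measure0.
rewrite iid_prefixS// [RHS]iid_prefixS//; apply: eq_integral => t _.
by apply: IH; [exact: measurable_slice|exact: prefix_determined_slice].
Qed.

Lemma iid_prefix_stable m n A : measurable A -> prefix_determined n A -> (n <= m)%N ->
  iid_prefix m A = iid_prefix n A.
Proof.
move=> mA nA; elim: m => [|m IH]; first by rewrite leqn0 => /eqP->.
rewrite leq_eqVlt => /orP[/eqP->//|]; rewrite ltnS => nm.
rewrite iid_prefix_stableS; [exact: IH|exact: mA|exact: prefix_determined_le nA].
Qed.

Definition cylinder (A : set Omega) := measurable A /\ exists n, prefix_determined n A.

Lemma cylinder_slice t A : cylinder A -> cylinder (slice t A).
Proof.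
move=> [mA [n nA]]; split; first exact: measurable_slice.
by exists n; apply: prefix_determined_slice; exact: prefix_determined_le nA.
Qed.

(** Whichever number of determining coordinates [get] picks, the mass is the
    same by [iid_prefix_stable]. *)
Definition cylinder_mass (A : set Omega) : \bar R :=
  iid_prefix (get [set n | prefix_determined n A]) A.

Lemma cylinder_massE n A : measurable A -> prefix_determined n A ->
  cylinder_mass A = iid_prefix n A.
Proof.
move=> mA nA; rewrite /cylinder_mass; set k := get _.
have kA : prefix_determined k A.
  by apply: (@getPex _ [set n | prefix_determined n A]); exists n.
have [kn|nk] := leqP k n; first by rewrite (iid_prefix_stable mA kA kn).
by rewrite (iid_prefix_stable mA nA (ltnW nk)).
Qed.

Lemma cylinder_mass_slice A : cylinder A ->
  cylinder_mass A = (\int[mu]_t cylinder_mass (slice t A))%E.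
Proof.
move=> [mA [n nA]]; have nA' := prefix_determined_le (leqnSn n) nA.
rewrite (cylinder_massE mA nA') iid_prefixS//; apply: eq_integral => t _.
by rewrite (cylinder_massE (measurable_slice t mA) (prefix_determined_slice nA')).
Qed.

Lemma measurable_cylinder_mass_slice A : cylinder A ->
  measurable_fun [set: T] (fun t => cylinder_mass (slice t A) : \bar R).
Proof.
move=> [mA [n nA]]; have nA' := prefix_determined_le (leqnSn n) nA.
rewrite (_ : (fun t => _) = fun t => iid_prefix n (slice t A)).
  exact: measurable_iid_prefix_slice.
apply/funext => t.
by rewrite (cylinder_massE (measurable_slice t mA) (prefix_determined_slice nA')).
Qed.

End product.

Section product_additivity.
Context d (T : measurableType d) (R : realType) (mu : probability T R).
Local Notation Omega := (seqspace T).
Local Notation P := (cylinder_mass mu).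

Lemma cylinder_common (A B : set Omega) : cylinder A -> cylinder B ->
  exists n, [/\ P A = iid_prefix mu n A, P B = iid_prefix mu n B,
    prefix_determined n A & prefix_determined n B].
Proof.
move=> [mA [m Am]] [mB [n Bn]]; exists (maxn m n).
have Am' := prefix_determined_le (leq_maxl m n) Am.
have Bn' := prefix_determined_le (leq_maxr m n) Bn.
by split => //; exact: cylinder_massE.
Qed.

Lemma cylinder_mass_ge0 A : (0 <= P A)%E. Proof. exact: measure_ge0. Qed.

Lemma cylinder_mass_le1 A : cylinder A -> (P A <= 1)%E.
Proof. by move=> [mA _]; exact: probability_le1. Qed.

Lemma cylinder_mass_fin A : cylinder A -> P A \is a fin_num.
Proof. by move=> [mA _]; exact: fin_num_measure. Qed.

Lemma le_cylinder_mass A B : cylinder A -> cylinder B -> A `<=` B -> (P A <= P B)%E.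
Proof.
move=> cA cB AB; have [n [-> -> _ _]] := cylinder_common cA cB.
by apply: le_measure; rewrite ?inE//; [exact: cA.1|exact: cB.1].
Qed.

Definition persistent (B : nat -> set Omega) : Prop :=
  [/\ forall m, cylinder (B m), nonincreasing_seq B &
      ~ (P (B m) @[m --> \oo] --> 0%E)].

(** The mass of a cylinder is the mean of the masses of its slices, so by
    dominated convergence these cannot all tend to zero. *)
Lemma persistent_slice B : persistent B ->
  exists t, persistent (fun m => slice t (B m)).
Proof.
move=> [cB nB B0]; apply: contrapT => /forallNP H; apply: B0.
have H' t : P (slice t (B m)) @[m --> \oo] --> 0%E.
  apply: contrapT => Ht; apply: (H t); split => //.
  - by move=> m; exact: cylinder_slice.
  - by move=> m n /nB/subsetPset mn; apply/subsetPset => w; exact: mn.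
rewrite (_ : (fun m => P (B m)) = fun m => \int[mu]_t P (slice t (B m)))%E; last first.
  by apply/funext => m; exact: cylinder_mass_slice.
rewrite -(@integral0 _ _ _ mu setT).
apply: (@dominated_cvg _ T R mu setT measurableT
  (fun m t => P (slice t (B m))) (cst 0%E) (cst 1%E)) => //.
- by move=> m; exact: measurable_cylinder_mass_slice.
- by move=> t _; exact: H'.
- exact: (@finite_measure_integrable_cst _ _ _ mu setT 1 measurableT).
- move=> m t _; rewrite gee0_abs ?cylinder_mass_ge0//.
  exact/cylinder_mass_le1/cylinder_slice.
Qed.

(** Choosing by [persistent_slice] the coordinates one after the other yields a
    sequence [w] each of whose finite beginnings leaves a nonempty slice of every
    [B m].  As [B m] depends on finitely many coordinates, it contains [w]. *)
Lemma persistent_bigcap B : persistent B -> (\bigcap_m B m) !=set0.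
Proof.
move=> pB.
have /choice[f fP] (C : {C | persistent C}) :
  exists t, persistent (fun m => slice t (sval C m)).
  exact/persistent_slice/(svalP C).
pose step (C : {C | persistent C}) : {C | persistent C} := exist _ _ (fP C).
pose C k := iter k step (exist _ _ pB).
pose w : Omega := fun k => f (C k).
pose tail k : Omega := fun i => w (k + i)%N.
have headE k : scons (f (C k), tail k.+1) = tail k.
  by apply/funext => -[|i]; rewrite /tail/= ?addn0// addSnnS.
have CS k m : sval (C k.+1) m (tail k.+1) = sval (C k) m (tail k).
  by rewrite /= -/(C k) /slice/= headE.
have Cw k m : sval (C k) m (tail k) = B m w.
  elim: k => [|k IH]; last by rewrite CS.
  by rewrite /= (_ : tail 0%N = w).
exists w => m _.
have [cB _ _] := pB; have [_ [n nB]] := cB m.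
(* After n slices no coordinate matters any more for B m. *)
have Cdim k : (k <= n)%N -> prefix_determined (n - k) (sval (C k) m).
  elim: k => [|k IH] kn; first by rewrite subn0.
  by apply: prefix_determined_slice; rewrite subnSK//; exact/IH/ltnW.
have [cCn nCn CnN0] := svalP (C n).
rewrite -(Cw n m).
have : sval (C n) m !=set0.
  apply: contrapT => /set0P/negP/negPn/eqP Cm0; apply: CnN0.
  apply: (@cvg_near_cst _ (\bar R)); exists m => // p /= mp.
  apply/eqP; rewrite eq_le cylinder_mass_ge0 andbT.
  apply: (@le_trans _ _ (P (sval (C n) m))).
    by apply: le_cylinder_mass => //; exact/subsetPset/nCn.
  by rewrite Cm0 [X in (X <= _)%E]measure0.
move=> [v Cv]; have := Cdim n (leqnn n); rewrite subnn => /(_ v (tail n)).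
exact.
Qed.

Lemma cylinder_mass0 : P set0 = 0%E. Proof. exact: measure0. Qed.

End product_additivity.

Section cylinder_algebra.
Context d (T : measurableType d).
Local Notation Omega := (seqspace T).

Lemma cylinderT : cylinder [set: Omega].
Proof. by split => //; exists 0%N. Qed.

Lemma cylinderD (A B : set Omega) : cylinder A -> cylinder B -> cylinder (A `\` B).
Proof.
move=> [mA [m Am]] [mB [n Bn]]; split; first exact: measurableD.
exists (maxn m n) => w w' ww' [Aw NBw]; split.
  by apply: Am Aw => i im; apply/ww'/(leq_trans im)/leq_maxl.
apply: contra_not NBw; apply: Bn => i im.
by apply/esym/ww'/(leq_trans im)/leq_maxr.
Qed.

(** A copy of the sequence space on which measurable means cylinder, so that the
    extension theorem for algebras of sets applies to [cylinder_mass]. *)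
Definition cylinder_display : measure_display. Proof. exact: d. Qed.
Definition cylinderType : Type := Omega.
HB.instance Definition _ := Pointed.on cylinderType.
HB.instance Definition _ := @isAlgebraOfSets_setD.Build cylinder_display
  cylinderType (@cylinder _ T) cylinderT cylinderD.

End cylinder_algebra.

Section product_measure.
Context d (T : measurableType d) (R : realType) (mu : probability T R).
Local Notation Omega := (seqspace T).
Local Notation P := (cylinder_mass mu).

Lemma cylinder_massU (A B : set Omega) : cylinder A -> cylinder B -> [disjoint A & B] ->
  P (A `|` B) = (P A + P B)%E.
Proof.
move=> cA cB AB; have [n [-> -> nA nB]] := cylinder_common mu cA cB.
have mAB : measurable (A `|` B) by apply: measurableU; [exact: cA.1|exact: cB.1].
rewrite (@cylinder_massE _ _ _ _ n)//.
  by apply: measureU; [exact: cA.1|exact: cB.1|exact/eqP].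
by move=> w w' ww' [/(nA _ _ ww')|/(nB _ _ ww')]; [left|right].
Qed.

(** Countable additivity amounts to the vanishing of the masses of the
    remainders [B n], which decrease to the empty set. *)
Lemma cylinder_mass_sigma_additive : semi_sigma_additive (P : set (cylinderType T) -> \bar R).
Proof.
move=> F mF tF mUF.
pose U n := \big[setU/set0]_(i < n) F i.
have cU n : cylinder (U n) by exact: (@bigsetU_measurable _ (cylinderType T)).
have UE n : (\sum_(0 <= i < n) P (F i))%E = P (U n).
  elim: n => [|n IH]; first by rewrite big_geq// /U big_ord0 cylinder_mass0.
  rewrite big_nat_recr//= IH /U big_ord_recr/= (cylinder_massU (cU n) (mF n))//.
  apply/disj_setPS => w []; rewrite /U.
  rewrite -bigcup_mkord => -[i /= ni Fi] Fn.
  by have /eqP := tF i n I I (ex_intro _ w (conj Fi Fn)); rewrite ltn_eqF.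
rewrite (eq_cvg _ _ UE).
pose B n := (\bigcup_i F i) `\` U n.
have cB n : cylinder (B n) by exact: cylinderD.
have PB n : P (U n) = (P (\bigcup_i F i) - P (B n))%E.
  have -> : P (\bigcup_i F i) = (P (U n) + P (B n))%E.
    rewrite -cylinder_massU//; last by apply/disj_setPS => w [? []].
    rewrite setDUK// /U -bigcup_mkord.
    by apply: bigcup_sub => i _; exact: bigcup_sup.
  by rewrite addeK//; exact: cylinder_mass_fin.
have P0 : P (B n) @[n --> \oo] --> 0%E.
  apply: contrapT => nP0; have [|w Bw] := @persistent_bigcap _ _ _ mu B.
  - split => // m n mn; apply/subsetPset => w [Fw nUw]; split => //.
    by apply: contra_not nUw; exact/subset_bigsetU.
  - have [i _ Fiw] := (Bw 0%N I).1; apply: (Bw i.+1 I).2.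
    by rewrite /U -bigcup_mkord; exists i => /=.
rewrite (eq_cvg _ _ PB) -[P (\bigcup_n F n) in X in _ --> X]sube0.
apply: cvgeB => //; last exact: cvg_cst.
by rewrite fin_num_adde_defl.
Qed.

HB.instance Definition _ := isMeasure.Build _ (cylinderType T) R
  (P : set (cylinderType T) -> \bar R) (cylinder_mass0 mu)
  (cylinder_mass_ge0 mu) cylinder_mass_sigma_additive.

Lemma sigma_cylinder :
  @measurable _ Omega = <<s @measurable _ (cylinderType T) >>.
Proof.
apply/seteqP; split; apply: smallest_sub => //.
- move=> _ [i _ [A mA <-]]; apply: sub_sigma_algebra; split.
    by rewrite setTI -[X in measurable X]setTI; exact: measurable_coord.
  by exists i.+1 => w w' ww' [_ Aw]; split => //=; rewrite -ww'.
- exact: sigma_algebra_measurable.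
- by move=> A [].
Qed.

Definition iid_measure : set Omega -> \bar R :=
  @measure_extension _ (cylinderType T) R P.

Let iid_measure0 : iid_measure set0 = 0%E.
Proof. exact: measure0. Qed.

Let iid_measure_ge0 A : (0 <= iid_measure A)%E.
Proof. exact: measure_ge0. Qed.

Let iid_measure_sigma_additive : semi_sigma_additive iid_measure.
Proof.
move=> F mF tF mUF; rewrite sigma_cylinder in mF mUF.
exact: (@measure_semi_sigma_additive _ _ _ (@measure_extension _ (cylinderType T) R P)).
Qed.

HB.instance Definition _ := isMeasure.Build _ _ _ iid_measure
  iid_measure0 iid_measure_ge0 iid_measure_sigma_additive.

Lemma iid_measure_cylinder A : cylinder A -> iid_measure A = P A.
Proof. by move=> cA; exact: (@measurable_mu_extE _ _ (cylinderType T)). Qed.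

Let iid_measureT : iid_measure setT = 1%E.
Proof. rewrite iid_measure_cylinder; last exact: cylinderT. exact: probability_setT. Qed.

HB.instance Definition _ := Measure_isProbability.Build _ _ _ iid_measure iid_measureT.

End product_measure.

Section boxes.
Context d (T : measurableType d) (R : realType) (mu : probability T R).
Local Notation Omega := (seqspace T).

Definition iid_prob : probability Omega R := iid_measure mu.

Definition box n (A : nat -> set T) : set Omega :=
  [set w | forall i, (i < n)%N -> A i (w i)].

Lemma slice_box n A t :
  slice t (box n.+1 A) = if t \in A 0%N then box n (A \o succn) else set0.
Proof.
apply/seteqP; split => [w Aw|w].
  by rewrite mem_set; [move=> i ni; exact: (Aw i.+1)|exact: (Aw 0%N)].
by case: ifPn => // /set_mem A0 Aw [|i]// ni; exact: Aw.
Qed.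

Lemma measurable_box n A : (forall i, measurable (A i)) -> measurable (box n A).
Proof.
move=> mA; rewrite (_ : box n A = \bigcap_(i in `I_n) (fun w : Omega => w i) @^-1` A i).
  apply: bigcap_measurableType => i _.
  by rewrite -[X in measurable X]setTI; exact: measurable_coord.
by apply/seteqP; split => w.
Qed.

Lemma iid_prefix_box n A : (forall i, measurable (A i)) ->
  iid_prefix mu n (box n A) = (\prod_(i < n) mu (A i))%E.
Proof.
elim: n A => [|n IH] A mA.
  rewrite big_ord0 (_ : box 0 A = setT) ?probability_setT//.
  by apply/seteqP; split.
rewrite iid_prefixS; last exact: measurable_box.
under eq_integral do rewrite slice_box.
rewrite big_ord_recl -(IH (A \o succn)) => [|i]; last exact: mA.
rewrite (eq_integral (fun t => iid_prefix mu n (box n (A \o succn)) * (\1_(A 0%N) t)%:E))%E.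
  rewrite ge0_integralZl//=; last exact/measurable_EFinP/measurable_indic.
  by rewrite integral_indic// setIT muleC.
move=> t _; rewrite indicE; case: ifPn => tA; first by rewrite mule1.
by rewrite mule0 measure0.
Qed.

Lemma iid_prob_box n A : (forall i, measurable (A i)) ->
  iid_prob (box n A) = (\prod_(i < n) mu (A i))%E.
Proof.
move=> mA; have nA : prefix_determined n (box n A).
  by move=> w w' ww' Aw i ni; rewrite -ww'//; exact: Aw.
rewrite /iid_prob/= iid_measure_cylinder; last first.
  by split; [exact: measurable_box|exists n].
by rewrite (cylinder_massE _ _ nA) ?iid_prefix_box//; exact: measurable_box.
Qed.

(** The boxes are stable under intersection and generate the sigma-algebra. *)
Lemma iid_prob_unique (Q : probability Omega R) :
  (forall n A, (forall i, measurable (A i)) ->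
     Q (box n A) = \prod_(i < n) mu (A i))%E ->
  forall A, measurable A -> Q A = iid_prob A.
Proof.
move=> QE.
pose G := [set B | exists n A, (forall i, measurable (A i)) /\ B = box n A].
apply: (probability_eq_generator (G := G)).
- apply/seteqP; split; apply: smallest_sub => //.
  + move=> _ [i _ [A mA <-]]; apply: sub_sigma_algebra.
    exists i.+1, (fun j => if j == i then A else setT); split.
      by move=> j; case: ifP.
    apply/seteqP; split => [w [_ Aw] j|w Aw]; first by case: eqP => // ->.
    by split => //=; have := Aw i (ltnSn i); rewrite eqxx.
  + exact: sigma_algebra_measurable.
  + by move=> _ [n [A [mA ->]]]; exact: measurable_box.
- move=> _ _ [n [A [mA ->]]] [m [B [mB ->]]].
  exists (maxn n m), (fun i => (if (i < n)%N then A i else setT) `&`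
    (if (i < m)%N then B i else setT)); split.
    by move=> i; apply: measurableI; case: ifP.
  apply/seteqP; split => [w [Aw Bw] i _|w ABw].
    by split; case: ifP => // ?; [exact: Aw|exact: Bw].
  split => i ni.
    by have [] := ABw i (leq_trans ni (leq_maxl n m)); rewrite ni.
  by have [_] := ABw i (leq_trans ni (leq_maxr n m)); rewrite ni.
- by move=> _ [n [A [mA ->]]]; rewrite QE// iid_prob_box.
Qed.

Lemma iid_prob_cap (s : seq nat) (B : nat -> set T) :
  uniq s -> (forall i, measurable (B i)) ->
  iid_prob (\bigcap_(i in [set` s]) ((fun w : Omega => w i) @^-1` B i)) =
  (\prod_(i <- s) mu (B i))%E.
Proof.
move=> us mB; pose n := (\max_(i <- s) i).+1.
pose A i := if i \in s then B i else setT.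
have sn i : i \in s -> (i < n)%N.
  by move=> si; rewrite ltnS; exact: leq_bigmax_seq.
(* The coordinates outside s are unconstrained and contribute factors 1. *)
rewrite (_ : \bigcap_(i in _) _ = box n A); last first.
  apply/seteqP; split => [w Bw i _|w Aw i /= si].
    by rewrite /A; case: ifPn => // /Bw.
  by have := Aw i (sn i si); rewrite /A si.
rewrite iid_prob_box => [|i]; last by rewrite /A; case: ifP.
rewrite -(big_mkord xpredT (fun i => mu (A i))).
rewrite (bigID (mem s))/= [X in (_ * X)%E]big1 => [|i /negbTE si]; last first.
  by rewrite /A si probability_setT.
rewrite mule1 -big_filter.
transitivity (\prod_(i <- s) mu (A i))%E.
  apply: perm_big; apply: uniq_perm => //; first exact/filter_uniq/iota_uniq.
  move=> i; rewrite mem_filter mem_index_iota /=.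
  by case: (boolP (i \in s)) => //= /sn ->.
by apply: eq_big_seq => i si; rewrite /A si.
Qed.

End boxes.

Section iid_sequences.
Context d (Omega : measurableType d) (R : realType) (Pr : probability Omega R).
Context d' (T : measurableType d') (Z : nat -> {RV Pr >-> T}).

Definition seqRV (w : Omega) : seqspace T := fun i => Z i w.

Lemma measurable_seqRV : measurable_fun setT seqRV.
Proof. by apply: measurable_seqP => i; exact: measurable_funP. Qed.

Lemma law_seqRV (mu : probability T R) : iid Z mu ->
  forall A, measurable A -> law Pr measurable_seqRV A = iid_prob mu A.
Proof.
move=> [Zmu Zind]; apply: iid_prob_unique => n A mA.
rewrite lawE (_ : _ @^-1` _ = \bigcap_(i in [set` iota 0 n]) (Z i @^-1` A i)).
  rewrite Zind ?iota_uniq// -(big_mkord xpredT (fun i => mu (A i))).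
  rewrite /index_iota subn0.
  by apply: eq_bigr => i _; rewrite -(Zmu i).
apply/seteqP; split => w Aw i /=.
  by rewrite mem_iota/= add0n => /Aw.
by move=> ni; apply: (Aw i); rewrite /= mem_iota.
Qed.

Lemma sigma_seqE A : sigma_seq Z A ->
  exists2 B : set (seqspace T), measurable B & A = seqRV @^-1` B.
Proof.
suff: sigma_seq Z `<=` preimage_set_system setT seqRV measurable.
  by move=> sub /sub[B mB <-]; exists B => //; rewrite setTI.
apply: smallest_sub; first by apply: sigma_algebra_preimage; exact: sigma_algebra_measurable.
move=> _ [i _ [B mB <-]]; exists ((fun w => w i) @^-1` B) => //.
rewrite -[X in measurable X]setTI; exact: measurable_coord.
Qed.

Lemma sigma_seq_preimage B : measurable B -> sigma_seq Z (seqRV @^-1` B).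
Proof.
move=> mB; suff: measurable `<=` image_set_system setT seqRV (sigma_seq Z).
  by move=> /(_ _ mB); rewrite /image_set_system/= setTI.
apply: smallest_sub.
  by apply: sigma_algebra_image; exact: smallest_sigma_algebra.
move=> _ [i _ [C mC <-]]; rewrite /image_set_system/= !setTI.
by apply: sub_sigma_algebra; exists i => //; exists C => //; rewrite setTI.
Qed.

End iid_sequences.

(** * The Hahn-Banach theorem and finite transport *)

Section hahn_banach.
Context (R : realType) (V : lmodType R).
Implicit Types (p q : V -> R) (x y e : V).

Definition sublinear p : Prop :=
  (forall x y, p (x + y) <= p x + p y) /\
  (forall t x, 0 <= t -> p (t *: x) = t * p x).

(** For a sublinear functional this identity on one vector already gives
    linearity on the line through [e]. *)
Definition linear_along p e : Prop := p (- e) = - p e.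

Lemma sublinear0 p : sublinear p -> p 0 = 0.
Proof. by move=> [_ /(_ 0 0 (lexx _))]; rewrite scale0r mul0r. Qed.

Lemma sublinearN p x : sublinear p -> - p x <= p (- x).
Proof.
move=> sp; have := sp.1 x (- x); rewrite subrr (sublinear0 sp); lra.
Qed.

(** Linearity along a vector survives any decrease of the functional: there is
    no room between [p e] and [- p (- e)]. *)
Lemma linear_along_le p q e : sublinear q -> (forall x, q x <= p x) ->
  linear_along p e -> linear_along q e /\ q e = p e.
Proof.
rewrite /linear_along => sq qp pe; have := qp e; have := qp (- e).
by have := sublinearN e sq; rewrite pe; split; lra.
Qed.

Lemma linear_alongZ p e t : sublinear p -> linear_along p e ->
  p (t *: e) = t * p e.
Proof.
rewrite /linear_along => -[_ pZ] pe; have [t0|t0] := leP 0 t; first exact: pZ.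
by rewrite -[t]opprK scaleNr -scalerN pZ ?oppr_ge0 ?ltW// pe mulrN !mulNr !opprK.
Qed.

Lemma linear_along_sum p (I : finType) (e : I -> V) (t : I -> R) :
  sublinear p -> (forall i, linear_along p (e i)) ->
  p (\sum_i t i *: e i) = \sum_i t i * p (e i).
Proof.
move=> sp pe.
have le (u : I -> R) : p (\sum_i u i *: e i) <= \sum_i u i * p (e i).
  elim/big_ind2 : _ => [|x1 x2 y1 y2 h1 h2|i _]; first by rewrite (sublinear0 sp).
    by rewrite (le_trans (sp.1 _ _))// lerD.
  by rewrite linear_alongZ.
apply/eqP; rewrite eq_le le/=.
have := le (fun i => - t i).
rewrite (_ : \sum_i - t i *: e i = - \sum_i t i *: e i); last first.
  by rewrite -sumrN; apply: eq_bigr => i _; rewrite scaleNr.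
rewrite (_ : \sum_i - t i * p (e i) = - \sum_i t i * p (e i)); last first.
  by rewrite -sumrN; apply: eq_bigr => i _; rewrite mulNr.
have := sublinearN (\sum_i t i *: e i) sp; lra.
Qed.

(** One step of the Hahn-Banach theorem: the infimum over [t >= 0] of
    [p (x + t e) - t p e] is again sublinear, lies below [p], and is linear
    along [e]. *)
Lemma sublinear_straighten p e : sublinear p ->
  exists q, [/\ sublinear q, forall x, q x <= p x, linear_along q e & q e = p e].
Proof.
move=> sp; have [pD pZ] := sp.
pose E x := [set p (x + t *: e) - t * p e | t in [set t | 0 <= t]].
have Elb x : lbound (E x) (- p (- x)).
  move=> _ [t /= t0 <-]; have := pD (x + t *: e) (- x).
  rewrite addrAC subrr add0r pZ//; lra.
have E0 x : E x !=set0 by exists (p (x + 0 *: e) - 0 * p e), 0 => /=.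
have Einf x : has_inf (E x) by split => //; exists (- p (- x)).
pose q x := inf (E x).
have qlb x t : 0 <= t -> q x <= p (x + t *: e) - t * p e.
  by move=> t0; apply: ge_inf; [exact: (Einf x).2|exists t].
have qp x : q x <= p x.
  by have := qlb x 0 (lexx _); rewrite scale0r addr0 mul0r subr0.
have lbq x z : (forall t, 0 <= t -> z <= p (x + t *: e) - t * p e) -> z <= q x.
  by move=> H; apply: lb_le_inf => // _ [t /= t0 <-]; exact: H.
have sq : sublinear q; first split.
- move=> x y; rewrite -lerBlDr; apply: (lbq) => s s0; rewrite lerBlDl -lerBlDr.
  apply: (lbq) => t t0; have := qlb (x + y) (s + t) (addr_ge0 s0 t0).
  have := pD (x + s *: e) (y + t *: e); rewrite addrACA -scalerDl; lra.
- have pos t x : 0 < t -> q (t *: x) <= t * q x.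
    move=> t0; rewrite -ler_pdivrMl//; apply: (lbq) => s s0.
    rewrite ler_pdivrMl//; have := qlb (t *: x) (t * s) (mulr_ge0 (ltW t0) s0).
    rewrite -scalerA -scalerDr pZ ?(ltW t0)//; lra.
  move=> t x; rewrite le_eqVlt => /predU1P[<-|t0].
    rewrite scale0r mul0r; apply/eqP; rewrite eq_le.
    rewrite (le_trans (qp _)) ?(sublinear0 sp)//=.
    by apply: (lbq) => s s0; rewrite add0r pZ// subrr.
  apply/eqP; rewrite eq_le pos//=.
  have := pos t^-1 (t *: x); rewrite invr_gt0 => /(_ t0).
  by rewrite scalerA mulVf ?gt_eqF// scale1r ler_pdivlMl.
have qN : q (- e) <= - p e.
  have := qlb (- e) 1 ler01.
  by rewrite scale1r addNr (sublinear0 sp) mul1r sub0r.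
by exists q; split => //; have := sublinearN e sq; have := qp e;
  rewrite /linear_along; lra.
Qed.

Lemma hahn_banach_seq p (s : seq V) : sublinear p ->
  exists q, [/\ sublinear q, forall y, q y <= p y &
    forall e, e \in s -> linear_along q e].
Proof.
move=> sp; elim: s => [|e s [q [sq qp qs]]]; first by exists p.
have [r [sr rq re _]] := sublinear_straighten e sq.
exists r; split => // [y|f]; first exact: le_trans (rq y) (qp y).
rewrite inE => /predU1P[->//|fs].
by have [] := linear_along_le sr rq (qs f fs).
Qed.

(** Linearity along finitely many vectors is enough here, since they may be
    taken to span the space, and a finite iteration replaces Zorn's lemma.
    Treating [x] first keeps the value of [p] at [x]. *)
Lemma hahn_banach p x (s : seq V) : sublinear p ->
  exists q, [/\ sublinear q, forall y, q y <= p y, q x = p x, linear_along q x &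
    forall e, e \in s -> linear_along q e].
Proof.
move=> sp; have [q [sq qp qx qxE]] := sublinear_straighten x sp.
have [r [sr rq rs]] := hahn_banach_seq s sq.
have [rx rxE] := linear_along_le sr rq qx.
exists r; split => // [y|]; first exact: le_trans (rq y) (qp y).
by rewrite rxE.
Qed.

End hahn_banach.

Section finite_transport.
Context (R : realType) (n : nat) (a b : 'I_n -> R).
Hypotheses (a_ge0 : forall i, 0 <= a i) (b_ge0 : forall j, 0 <= b j).
Hypotheses (a1 : \sum_i a i = 1) (b1 : \sum_j b j = 1).

(** The total income when [u i] is paid for each unit of mass leaving [i] and
    [v j] for each unit reaching [j]. *)
Definition dual_value (u v : 'I_n -> R) : R := \sum_i u i * a i + \sum_j v j * b j.

Definition dual_values (h : 'M[R]_n) : set R :=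
  [set dual_value uv.1 uv.2 |
    uv in [set uv : ('I_n -> R) * ('I_n -> R) | forall i j, h i j <= uv.1 i + uv.2 j]].

Let p h := inf (dual_values h).

(** The dual value is the cost of the independent plan for the separated cost
    [u i + v j]. *)
Lemma dual_valueE u v : dual_value u v = \sum_i \sum_j a i * b j * (u i + v j).
Proof.
transitivity (\sum_i \sum_j (a i * u i * b j) + \sum_i \sum_j a i * (v j * b j)).
  congr (_ + _).
    by apply: eq_bigr => i _; rewrite -mulr_sumr b1 mulr1 mulrC.
  by under [RHS]eq_bigr do rewrite -mulr_sumr; rewrite -mulr_suml a1 mul1r.
rewrite -big_split; apply: eq_bigr => i _; rewrite -big_split.
by apply: eq_bigr => j _ /=; ring.
Qed.

Lemma has_inf_dual_values h : has_inf (dual_values h).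
Proof.
split.
  pose K := \sum_i \sum_j `|h i j|.
  exists (dual_value (fun=> K) (fun=> 0)), (fun=> K, fun=> 0) => //= i j.
  rewrite addr0 (le_trans (ler_norm _))// /K (bigD1 i)//= (bigD1 j)//=.
  by rewrite -addrA lerDl addr_ge0 ?sumr_ge0// => k _; rewrite sumr_ge0.
exists (\sum_i \sum_j a i * b j * h i j) => _ [[u v] /= uvh <-].
rewrite dual_valueE; apply: ler_sum => i _; apply: ler_sum => j _.
by rewrite ler_wpM2l ?mulr_ge0.
Qed.

Lemma inf_dual_le (h : 'M[R]_n) u v :
  (forall i j, h i j <= u i + v j) -> p h <= dual_value u v.
Proof. by move=> uvh; apply: ge_inf; [exact: (has_inf_dual_values h).2|exists (u, v)]. Qed.

Lemma le_inf_dual (h : 'M[R]_n) z :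
  (forall u v, (forall i j, h i j <= u i + v j) -> z <= dual_value u v) -> z <= p h.
Proof.
move=> H; apply: lb_le_inf; first exact: (has_inf_dual_values h).1.
by move=> _ [[u v] /= uvh <-]; exact: H.
Qed.

Lemma dual_valueD u v u' v' :
  dual_value (u \+ u') (v \+ v') = dual_value u v + dual_value u' v'.
Proof.
rewrite /dual_value [RHS]addrACA; congr (_ + _); rewrite -big_split;
  by apply: eq_bigr => i _ /=; rewrite mulrDl.
Qed.

Lemma dual_valueZ t u v :
  dual_value (fun i => t * u i) (fun j => t * v j) = t * dual_value u v.
Proof.
rewrite /dual_value mulrDr; congr (_ + _); rewrite mulr_sumr;
  by apply: eq_bigr => i _ /=; rewrite mulrA.
Qed.

Lemma sublinear_inf_dual : sublinear (p : 'M[R]_n -> R).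
Proof.
split=> [g h|].
  rewrite -lerBlDr; apply: le_inf_dual => u v uvg; rewrite lerBlDl -lerBlDr.
  apply: le_inf_dual => u' v' uvh; rewrite lerBlDr addrC -dual_valueD.
  by apply: inf_dual_le => i j; rewrite mxE/= addrACA lerD.
have pos t h : 0 < t -> p (t *: h) <= t * p h.
  move=> t0; rewrite -ler_pdivrMl//; apply: le_inf_dual => u v uvh.
  rewrite ler_pdivrMl// -dual_valueZ; apply: inf_dual_le => i j.
  by rewrite mxE -mulrDr ler_wpM2l// ltW.
move=> t h; rewrite le_eqVlt => /predU1P[<-|t0].
  rewrite scale0r mul0r; apply/eqP; rewrite eq_le; apply/andP; split.
    rewrite (_ : 0 = dual_value (fun=> 0) (fun=> 0)).
      by apply: inf_dual_le => i j; rewrite mxE addr0.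
    by rewrite /dual_value !big1 ?addr0// => i _; rewrite mul0r.
  apply: le_inf_dual => u v uv0; rewrite dual_valueE.
  apply: sumr_ge0 => i _; apply: sumr_ge0 => j _.
  by rewrite !mulr_ge0//; have := uv0 i j; rewrite mxE.
apply/eqP; rewrite eq_le pos//=.
have := pos t^-1 (t *: h); rewrite invr_gt0 => /(_ t0).
by rewrite scalerA mulVf ?gt_eqF// scale1r ler_pdivlMl.
Qed.

(** The functional [p h], the infimum of the dual values of the prices dominating
    [h], is sublinear on matrices.  A linear functional below [p] with the same
    value at [- c] has a matrix [m] of coefficients.  It is nonnegative since [p] is
    nonpositive on nonpositive matrices, it has the prescribed margins since [p]
    is linear on the separated matrices [u i + v j], and its value at [c] is
    [- p (- c)], the supremum of the dual values of the prices below [c]. *)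
Theorem finite_duality (c : 'M[R]_n) : exists m : 'M[R]_n,
  [/\ forall i j, 0 <= m i j, forall i, \sum_j m i j = a i,
      forall j, \sum_i m i j = b j &
      forall eps, 0 < eps -> exists u v : 'I_n -> R,
        (forall i j, u i + v j <= c i j) /\
        \sum_i \sum_j m i j * c i j <= dual_value u v + eps].
Proof.
pose e (ij : 'I_n * 'I_n) : 'M[R]_n := delta_mx ij.1 ij.2.
have [q [sq qp qc lqc qe]] := hahn_banach (- c) [seq e ij | ij <- enum {: 'I_n * 'I_n}]
  sublinear_inf_dual.
have {}qe ij : linear_along q (e ij) by apply: qe; by apply: map_f; rewrite mem_enum.
pose m := \matrix_(i, j) q (e (i, j)).
have qE h : q h = \sum_i \sum_j m i j * h i j.
  rewrite {1}[h]matrix_sum_delta pair_bigA/= linear_along_sum//.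
  by rewrite pair_bigA/=; apply: eq_bigr => -[i j] _; rewrite mxE mulrC.
have qN h : q (- h) = - q h.
  rewrite !qE -sumrN; apply: eq_bigr => i _; rewrite -sumrN.
  by apply: eq_bigr => j _; rewrite [X in _ * X]mxE mulrN.
have qdual u v : q (\matrix_(i, j) (u i + v j)) = dual_value u v.
  apply/eqP; rewrite eq_le; apply/andP; split.
    by rewrite (le_trans (qp _))// inf_dual_le// => i j; rewrite mxE.
  rewrite -lerN2 -qN -[leRHS]mulN1r -dual_valueZ (le_trans (qp _))// inf_dual_le// => i j.
  by rewrite !mxE; lra.
exists m; split => [i j|i|j|eps eps0].
- rewrite mxE -oppr_le0 -qN (le_trans (qp _))//.
  rewrite (_ : 0 = dual_value (fun=> 0) (fun=> 0)).
    by apply: inf_dual_le => k l; rewrite !mxE addr0 oppr_le0 ler0n.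
  by rewrite /dual_value !big1 ?addr0// => k _; rewrite mul0r.
(* Testing against the indicator of a row, then of a column. *)
- have := qdual (fun k => (k == i)%:R) (fun=> 0).
  rewrite /dual_value [X in _ + X]big1 ?addr0 => [|k _]; last by rewrite mul0r.
  rewrite (bigD1 i)//= eqxx mul1r big1 ?addr0 => [<-|k /negbTE->]; last by rewrite mul0r.
  rewrite qE [RHS](bigD1 i)//= [X in _ + X]big1 ?addr0 => [|k /negbTE ki].
    by apply: eq_bigr => j _; rewrite [X in _ * X]mxE eqxx addr0 mulr1.
  by rewrite big1// => j _; rewrite [X in _ * X]mxE ki addr0 mulr0.
- have := qdual (fun=> 0) (fun k => (k == j)%:R).
  rewrite /dual_value [X in X + _]big1 ?add0r => [|k _]; last by rewrite mul0r.
  rewrite (bigD1 j)//= eqxx mul1r big1 ?addr0 => [<-|k /negbTE->]; last by rewrite mul0r.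
  rewrite qE; apply: eq_bigr => i _.
  rewrite [RHS](bigD1 j)//= big1 ?addr0 => [|k /negbTE kj].
    by rewrite [X in _ * X]mxE eqxx add0r mulr1.
  by rewrite [X in _ * X]mxE kj add0r mulr0.
- have [_ [[u v] /= uvc <-] lt] :=
    inf_adherent eps0 (has_inf_dual_values (- c)).
  exists (\- u), (\- v); split => [i j|].
    by have := uvc i j; rewrite mxE /=; lra.
  have -> : dual_value (\- u) (\- v) = - dual_value u v.
    rewrite -mulN1r -dual_valueZ; congr dual_value; apply/funext => i;
    by rewrite mulN1r.
  rewrite -qE; move: qc lqc; rewrite /linear_along opprK => -> ->.
  by move: lt; rewrite -/(p (- c)); lra.
Qed.

End finite_transport.

Local Open Scope ereal_scope.

(** * Transport costs *)

Section integral_lemmas.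
Context d (T : measurableType d) (R : realType).

(** Monotonicity holds beyond measurable functions, the integral of a nonnegative
    function being a supremum over the simple functions below it. *)
Lemma ge0_le_integralT (mu : {measure set T -> \bar R}) (f g : T -> \bar R) :
  (forall x, 0 <= f x) -> (forall x, f x <= g x) ->
  \int[mu]_x f x <= \int[mu]_x g x.
Proof.
move=> f0 fg; have g0 x : 0 <= g x by exact: le_trans (fg x).
rewrite !ge0_integralTE//; apply: ereal_sup_le.
move=> _ [h hf <-]; exists h => // x; exact: le_trans (hf x) (fg x).
Qed.

Lemma integral_fibers (mu : {measure set T -> \bar R}) (I : finType)
    (S : T -> I) (h : I -> R) :
  (forall i, measurable (S @^-1` [set i])) -> (forall i, (0 <= h i)%R) ->
  \int[mu]_x (h (S x))%:E = \sum_i (h i)%:E * mu (S @^-1` [set i]).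
Proof.
move=> mS h0.
rewrite (eq_integral (fun x => \sum_i (h i)%:E * (\1_(S @^-1` [set i]) x)%:E)).
  rewrite ge0_integral_sum//=; last 2 first.
  - move=> i; apply: emeasurable_funM => //.
    by apply/measurable_EFinP; exact: measurable_indic.
  - by move=> i x _; rewrite mule_ge0// lee_fin.
  apply: eq_bigr => i _; rewrite ge0_integralZl//=; last first.
    by rewrite lee_fin.
  - by apply/measurable_EFinP; exact: measurable_indic.
  by rewrite integral_indic// setIT.
move=> x _; rewrite (bigD1 (S x))//= big1 ?adde0 => [|i /eqP iSx].
  by rewrite indicE mem_set// mule1.
by rewrite indicE memNset ?mule0// => /esym.
Qed.

Lemma measurable_fibers (I : finType) (S : T -> I) (h : I -> R) :
  (forall i, measurable (S @^-1` [set i])) ->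
  measurable_fun setT (fun x => h (S x)).
Proof.
move=> mS _ A mA; rewrite setTI.
rewrite (_ : _ @^-1` A = \bigcup_(i in [set i | A (h i)]) (S @^-1` [set i])).
  by apply: fin_bigcup_measurable => //; exact: finite_finset.
by apply/seteqP; split => [x Ax|x [i /= Ai Sxi]]; [exists (S x)|rewrite /= Sxi].
Qed.

Lemma measure_fibers (mu : {measure set T -> \bar R}) (I : finType)
    (S : T -> I) (A : set T) :
  (forall i, measurable (S @^-1` [set i])) -> measurable A ->
  mu A = \sum_i mu (A `&` S @^-1` [set i]).
Proof.
move=> mS mA.
have mAS i : measurable (A `&` S @^-1` [set i]) by exact: measurableI.
have -> : mu A = \int[mrestr mu mA]_x (cst 1%R (S x))%:E.
  by rewrite (eq_integral (cst 1))// integral_cst// mul1e -{1}(setTI A).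
rewrite integral_fibers//; apply: eq_bigr => i _.
by rewrite mul1e setIC.
Qed.

End integral_lemmas.

Section weak_duality.
Context d (T : measurableType d) (R : realType).
Implicit Types mu nu : probability T R.

Lemma coupling_integral1 mu nu g (f : T -> \bar R) : couplings mu nu g ->
  measurable_fun setT f -> (forall x, 0 <= f x) ->
  \int[g]_z f z.1 = \int[mu]_x f x.
Proof.
move=> [g1 _] mf f0.
transitivity (\int[law g measurable_fst]_x f x).
  by rewrite ge0_integral_pushforward//; exact: measurable_fst.
apply: eq_measure_integral => A mA _.
transitivity (g (A `*` setT)); last exact: g1.
by rewrite [LHS]lawE; congr (g _); apply/seteqP; split => // -[x y] [].
Qed.

Lemma coupling_integral2 mu nu g (f : T -> \bar R) : couplings mu nu g ->
  measurable_fun setT f -> (forall x, 0 <= f x) ->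
  \int[g]_z f z.2 = \int[nu]_x f x.
Proof.
move=> [_ g2] mf f0.
transitivity (\int[law g measurable_snd]_x f x).
  by rewrite ge0_integral_pushforward//; exact: measurable_snd.
apply: eq_measure_integral => A mA _.
transitivity (g (setT `*` A)); last exact: g2.
by rewrite [LHS]lawE; congr (g _); apply/seteqP; split => // -[x y] [].
Qed.

(** The easy half of Kantorovich duality: the difference [f x - f y] lies below
    the cost, and its integral depends on the margins only.  The positive part of
    the difference is a measurable minorant of [c], which need not be
    measurable; all the functions integrated are nonnegative. *)
Lemma transport_cost_ge mu nu (c : T -> T -> \bar R) (f : T -> R) :
  measurable_fun setT f -> (forall x, (0 <= f x)%R) -> (forall x y, 0 <= c x y) ->
  (forall x y, (f x)%:E <= c x y + (f y)%:E) ->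
  \int[mu]_x (f x)%:E <= transport_cost c mu nu + \int[nu]_x (f x)%:E.
Proof.
move=> mf f0 c0 fc.
have mfE : measurable_fun setT (fun x => (f x)%:E) by exact/measurable_EFinP.
have f0E x : 0 <= (f x)%:E by rewrite lee_fin.
rewrite /transport_cost.
have [->|nuf] := eqVneq (\int[nu]_x (f x)%:E) +oo.
  rewrite addey ?leey// gt_eqF// (@lt_le_trans _ _ 0)// le_ereal_inf_tmp//.
  by move=> _ [g _ <-]; exact: integral_ge0.
have nufin : \int[nu]_x (f x)%:E \is a fin_num.
  by rewrite ge0_fin_numE ?ltey// integral_ge0.
rewrite -leeBlDr//; apply: le_ereal_inf_tmp => _ [g cg <-].
rewrite leeBlDr//.
pose h z := maxe 0 ((f z.1)%:E - (f z.2)%:E).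
have mf1 : measurable_fun setT (fun z : T * T => (f z.1)%:E).
  exact: measurableT_comp mfE measurable_fst.
have mf2 : measurable_fun setT (fun z : T * T => (f z.2)%:E).
  exact: measurableT_comp mfE measurable_snd.
have mh : measurable_fun setT h.
  apply: measurable_maxe; first exact: measurable_cst.
  exact: emeasurable_funB.
have h0 z : 0 <= h z by rewrite /h le_max lexx.
have hc z : h z <= c z.1 z.2.
  by rewrite /h ge_max c0 andTb leeBlDr.
rewrite -(coupling_integral1 cg)// -(coupling_integral2 cg)//.
apply: (@le_trans _ _ (\int[g]_z (h z + (f z.2)%:E))).
  apply: ge0_le_integralT => // z.
  by rewrite -leeBlDr// /h le_max lexx orbT.
rewrite ge0_integralD//; apply: leeD2r; exact: ge0_le_integralT.
Qed.

Lemma transport_cost_ge0 mu nu (c : T -> T -> \bar R) :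
  (forall x y, 0 <= c x y) -> 0 <= transport_cost c mu nu.
Proof.
by move=> c0; apply: le_ereal_inf_tmp => _ [g _ <-]; exact: integral_ge0.
Qed.

End weak_duality.

Section weighted_sum.
Context d (T : measurableType d) (R : realType) (I : finType).
Variables (r : I -> R) (r_ge0 : forall i, (0 <= r i)%R)
  (m : I -> {measure set T -> \bar R}).

Definition weighted_sum (_ : forall i, (0 <= r i)%R) (A : set T) : \bar R :=
  \sum_i (r i)%:E * m i A.
Local Notation mu := (weighted_sum r_ge0).

Let mu0 : mu set0 = 0.
Proof. by rewrite /weighted_sum big1// => i _; rewrite measure0 mule0. Qed.

Let mu_ge0 A : 0 <= mu A.
Proof. by apply: sume_ge0 => i _; rewrite mule_ge0 ?lee_fin. Qed.

Let mu_sigma_additive : semi_sigma_additive mu.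
Proof.
move=> F mF tF mUF; rewrite /weighted_sum.
rewrite (_ : (fun n => _) =
    fun n => \sum_i (r i)%:E * \sum_(0 <= k < n) m i (F k)); last first.
  apply/funext => n; rewrite exchange_big/=; apply: eq_bigr => i _.
  by rewrite ge0_sume_distrr.
apply: cvg_nnesum => i _.
  by apply: nearW => n; rewrite mule_ge0 ?lee_fin ?sume_ge0.
by apply: cvgeZl => //; exact: measure_semi_sigma_additive.
Qed.

HB.instance Definition _ := isMeasure.Build _ _ _ mu mu0 mu_ge0 mu_sigma_additive.

End weighted_sum.

Section coupling_lift.
Context d (T : measurableType d) (R : realType) (n : nat).
Variables (P1 P2 : probability T R) (S : T -> 'I_n) (m : 'M[R]_n).
Hypothesis mS : forall i, measurable (S @^-1` [set i]).
Let a i := fine (P1 (S @^-1` [set i])).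
Let b i := fine (P2 (S @^-1` [set i])).
Hypotheses (m_ge0 : forall i j, (0 <= m i j)%R)
  (m_row : forall i, (\sum_j m i j = a i)%R)
  (m_col : forall j, (\sum_i m i j = b j)%R).

Let fib (ij : 'I_n * 'I_n) : set (T * T) :=
  (S @^-1` [set ij.1]) `*` (S @^-1` [set ij.2]).

Let mfib ij : measurable (fib ij).
Proof. exact: measurableX. Qed.

(** The density of the lifted coupling on the product of two cells; if one of
    them is null the division yields 0, which is right because [m] vanishes
    there. *)
Let r (ij : 'I_n * 'I_n) : R := (m ij.1 ij.2 / (a ij.1 * b ij.2))%R.

Let r_ge0 ij : (0 <= r ij)%R.
Proof. by rewrite divr_ge0// mulr_ge0 ?fine_ge0. Qed.

Let m_row0 i j : a i = 0%R -> m i j = 0%R.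
Proof. by rewrite -m_row => /psumr_eq0P; apply. Qed.

Let m_col0 i j : b j = 0%R -> m i j = 0%R.
Proof. by rewrite -m_col => /psumr_eq0P; apply. Qed.

Let g : set (T * T) -> \bar R :=
  weighted_sum (fun ij => mrestr (P1 \x P2) (mfib ij)) r_ge0.

HB.instance Definition _ := Measure.on g.

Let gE A B : measurable A -> measurable B -> g (A `*` B) =
  \sum_i \sum_j (r (i, j) * fine (P1 (A `&` S @^-1` [set i]))
                          * fine (P2 (B `&` S @^-1` [set j])))%:E.
Proof.
move=> mA mB; rewrite /g /weighted_sum pair_bigA/=; apply: eq_bigr => -[i j] _ /=.
have mAi : measurable (A `&` S @^-1` [set i]) by exact: measurableI.
have mBj : measurable (B `&` S @^-1` [set j]) by exact: measurableI.
rewrite -mulrA [RHS]EFinM; congr (_ * _).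
rewrite EFinM !fineK ?fin_num_measure// -product_measure1E// /mrestr.
by congr (_ _); apply/seteqP; split => -[x y] [] [? ?] [? ?].
Qed.

Let g1 A : measurable A -> g (A `*` setT) = P1 A.
Proof.
move=> mA; rewrite gE// (measure_fibers P1 mS mA).
apply: eq_bigr => i _; set x := P1 _.
have xfin : x \is a fin_num by apply: fin_num_measure; exact: measurableI.
have xa : a i = 0%R -> fine x = 0%R.
  move=> ai; apply/eqP; rewrite eq_le; apply/andP; split; last first.
    by apply: fine_ge0; exact: measure_ge0.
  rewrite -ai fine_le//; first exact: fin_num_measure.
  apply: le_measure; rewrite ?inE; [exact: measurableI|exact: mS|exact: subIsetr].
rewrite sumEFin -[RHS]fineK//; congr _%:E.
transitivity (\sum_j m i j / a i * fine x)%R.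
  apply: eq_bigr => j _; rewrite /r/= setTI -/(b j).
  have [bj|bj] := eqVneq (b j) 0%R; first by rewrite (m_col0 _ bj) !mul0r.
  have [ai|ai] := eqVneq (a i) 0%R; first by rewrite (m_row0 _ ai) !mul0r.
  by field; apply/andP.
rewrite -mulr_suml -mulr_suml m_row.
have [ai|ai] := eqVneq (a i) 0%R; first by rewrite xa// mulr0.
by rewrite divff// mul1r.
Qed.

Let g2 B : measurable B -> g (setT `*` B) = P2 B.
Proof.
move=> mB; rewrite gE// (measure_fibers P2 mS mB) exchange_big/=.
apply: eq_bigr => j _; set x := P2 _.
have xfin : x \is a fin_num by apply: fin_num_measure; exact: measurableI.
have xb : b j = 0%R -> fine x = 0%R.
  move=> bj; apply/eqP; rewrite eq_le; apply/andP; split; last first.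
    by apply: fine_ge0; exact: measure_ge0.
  rewrite -bj fine_le//; first exact: fin_num_measure.
  apply: le_measure; rewrite ?inE; [exact: measurableI|exact: mS|exact: subIsetr].
rewrite sumEFin -[RHS]fineK//; congr _%:E.
transitivity (\sum_i m i j / b j * fine x)%R.
  apply: eq_bigr => i _; rewrite /r/= setTI -/(a i).
  have [bj|bj] := eqVneq (b j) 0%R; first by rewrite (m_col0 _ bj) !mul0r.
  have [ai|ai] := eqVneq (a i) 0%R; first by rewrite (m_row0 _ ai) !mul0r.
  by field; apply/andP.
rewrite -mulr_suml -mulr_suml m_col.
have [bj|bj] := eqVneq (b j) 0%R; first by rewrite xb// mulr0.
by rewrite divff// mul1r.
Qed.

Let gT : g setT = 1.
Proof. by rewrite -setXTT g1// probability_setT. Qed.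

HB.instance Definition _ := Measure_isProbability.Build _ _ _ g gT.

(** A transport plan [m] between the masses of the cells of a finite partition
    lifts to a coupling that spreads [m i j] over the product of two cells
    proportionally to the product measure. *)
Lemma coupling_lift : exists2 g' : probability (T * T)%type R,
  couplings P1 P2 g' &
  forall i j, g' ((S @^-1` [set i]) `*` (S @^-1` [set j])) = (m i j)%:E.
Proof.
exists (g : probability _ _) => // i j.
have eqS k l : k != l -> S @^-1` [set l] `&` S @^-1` [set k] = set0.
  by move=> /eqP kl; apply/seteqP; split => // x [/= -> /esym].
rewrite [LHS]gE// (bigD1 i)//= [X in _ + X]big1 ?adde0 => [|k ki]; last first.
  by apply: big1 => l _; rewrite (eqS _ _ ki) measure0 mulr0 mul0r.
rewrite (bigD1 j)//= [X in _ + X]big1 ?adde0 => [|l lj]; last first.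
  by rewrite (eqS _ _ lj) measure0 mulr0.
rewrite !setIid /r/=; congr _%:E; rewrite -/(a i) -/(b j).
have [bj|bj] := eqVneq (b j) 0%R; first by rewrite (m_col0 _ bj) !mul0r.
have [ai|ai] := eqVneq (a i) 0%R; first by rewrite (m_row0 _ ai) !mul0r.
by field; apply/andP.
Qed.

End coupling_lift.

(** * Separable metric spaces *)

Section metric_measurability.
Context (R : realType).

Lemma continuous_borel (X : ptopologicalType) (f : X -> R) :
  continuous f -> measurable_fun setT (f : borelType X -> R).
Proof.
move=> cf; apply: (measurability (@RGenOInfty.G R)).
  exact: RGenOInfty.measurableE.
move=> _ [_ [x ->] <-]; rewrite setTI; apply: sub_sigma_algebra.
apply: (@open_comp X R) => //; exact: interval_open.
Qed.

Variable X : completeMetricType R.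

(** Exchanging [x] and [y], the one-sided bound is the 1-Lipschitz condition. *)
Lemma lipschitz_continuous (f : X -> R) :
  (forall x y, (f x <= mdist x y + f y)%R) -> continuous f.
Proof.
move=> lf x; apply/cvgrPdist_lt => e e0; near=> y.
have : ball x e y by near: y; exact: nbhsx_ballx.
rewrite ballEmdist/= => xye; have := lf x y; have := lf y x.
by rewrite (metric_sym y x) ltr_norml; move: xye; lra.
Unshelve. all: by end_near. Qed.

Hypothesis sepX : separable X.

Lemma dense_sequence : exists a : nat -> X,
  forall x e, (0 < e)%R -> exists k, (mdist x (a k) < e)%R.
Proof.
have [A cA dA] := sepX; have /countable_injP[f injf] := cA.
exists (fun n => get [set x | A x /\ f x = n]) => x e e0.
have [||y [By Ay]] := dA (ball x e)^°.
- by exists x; apply: nbhsx_ballx.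
- exact: open_interior.
exists (f y).
rewrite (_ : get _ = y); first by have := interior_subset By; rewrite ballEmdist.
have [Az fz] := getPex (ex_intro (fun x => A x /\ f x = f y) y (conj Ay erefl)).
by apply: injf; rewrite ?inE.
Qed.

(** The Borel sets of the product may exceed the product sigma-algebra in
    general, so continuity of the distance is not enough: separability writes
    [d(x, y) < r] as [d(x, a k) + d(y, a k) < r] for some [k]. *)
Lemma measurable_mdist : measurable_fun setT
  (fun z : borelType X * borelType X => mdist (z.1 : X) z.2).
Proof.
have [a da] := dense_sequence.
apply: (measurability (@RGenInftyO.G R)); first exact: RGenInftyO.measurableE.
move=> _ [_ [r ->] <-].
rewrite setTI (_ : _ @^-1` _ = \bigcup_k
  ((fun z : borelType X * borelType X => mdist (z.1 : X) (a k) + mdist (z.2 : X) (a k))%R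
    @^-1` `]-oo, r[)).
  apply: bigcupT_measurable => k; rewrite -[X in measurable X]setTI.
  have ma : measurable_fun setT (fun x : borelType X => mdist (x : X) (a k)).
    by apply: continuous_borel; apply: lipschitz_continuous => x y; exact: metric_triangle.
  apply: measurable_funD => //.
    exact: measurableT_comp ma measurable_fst.
  exact: measurableT_comp ma measurable_snd.
apply/seteqP; split => [[x y]|[x y] [k _]] /=; rewrite !in_itv/=.
  move=> xyr; have [|k xk] := da x ((r - mdist x y) / 2)%R; first by lra.
  exists k => //=; rewrite in_itv/=.
  by have := metric_triangle y x (a k); rewrite (metric_sym y x); lra.
by have := metric_triangle x (a k) y; rewrite (metric_sym (a k) y); lra.
Qed.

End metric_measurability.

(** * Kantorovich duality *)

Section kantorovich.
Context (R : realType) (X : completeMetricType R).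
Hypotheses (sepX : separable X) (bdX : bounded_diameter X).
Local Notation prob := (probability (borelType X) R).

(** Two probabilities are simultaneously almost carried by finitely many small
    cells; the last cell collects the remainder, of small mass but whose
    radius [delta] is only bounded by the diameter. *)
Lemma discretization (P1 P2 : prob) (eps : R) : (0 < eps)%R ->
  exists n (S : borelType X -> 'I_n) (rep : 'I_n -> X) (delta : 'I_n -> R),
  [/\ forall i, measurable (S @^-1` [set i]), forall i, (0 <= delta i)%R,
      forall x, (mdist (x : X) (rep (S x)) <= delta (S x))%R,
      \int[P1]_x (delta (S x))%:E <= eps%:E &
      \int[P2]_x (delta (S x))%:E <= eps%:E].
Proof.
move=> eps0; have [a da] := dense_sequence sepX; have [D dD] := bdX.
have D0 : (0 <= D)%R by rewrite (le_trans _ (dD point point))// mdist_ge0.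
pose e := (eps / 2)%R; have e0 : (0 < e)%R by rewrite divr_gt0.
(* A point belongs to the cell of the first a k at distance less than e. *)
pose first (x : borelType X) := ex_minn (da (x : X) e e0).
have firstP x : (mdist (x : X) (a (first x)) < e)%R.
  by rewrite /first; case: ex_minnP.
have first_min x k : (mdist (x : X) (a k) < e)%R -> (first x <= k)%N.
  by rewrite /first; case: ex_minnP => m _; exact.
pose B k : set (borelType X) := [set x | (mdist (x : X) (a k) < e)%R].
have mB k : measurable (B k).
  apply: sub_sigma_algebra; rewrite (_ : B k = (fun x : X => mdist x (a k)) @^-1` `]-oo, e[).
    apply: open_comp => [x _|]; last exact: interval_open.
    by apply: lipschitz_continuous => {}x y; exact: metric_triangle.
  by apply/seteqP; split => x; rewrite /= in_itv.
have mfirst1 k : measurable (first @^-1` [set k]).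
  rewrite (_ : _ @^-1` _ = B k `&` ~` \bigcup_(j < k) B j).
    apply: measurableI => //; apply: measurableC; exact: bigcup_measurable.
  apply/seteqP; split => [x /= <-|x /= [Bk nB]].
    split; first exact: firstP.
    by move=> [j /= jx /first_min]; rewrite leqNgt jx.
  apply/eqP; rewrite eqn_leq first_min//= leqNgt; apply/negP => xk.
  by apply: nB; exists (first x) => //; exact: firstP.
have mfirst (A : set nat) : measurable (first @^-1` A).
  rewrite (_ : _ @^-1` A = \bigcup_(k in A) (first @^-1` [set k])).
    exact: bigcup_measurable.
  by apply/seteqP; split => [x Ax|x [k Ak /= ->]//]; exists (first x).
pose F N := first @^-1` [set k | (N <= k)%N].
have F0 (P : prob) : P (F N) @[N --> \oo] --> 0%E.
  rewrite -(measure0 P) (_ : set0 = \bigcap_N F N); last first.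
    by apply/seteqP; split => // x /(_ (first x).+1 I); rewrite /F/= ltnn.
  apply: nonincreasing_cvg_mu => //.
  - by rewrite (le_lt_trans (probability_le1 _ _)) ?ltry//; exact: mfirst.
  - by move=> N; exact: mfirst.
  - by apply: bigcapT_measurable => N; exact: mfirst.
  - by move=> N M NM; apply/subsetPset => x /=; exact: leq_trans.
(* The last cell costs at most D times its mass; D + 1 avoids dividing by 0. *)
have De0 : (0 < e / (D + 1))%R by rewrite divr_gt0// ltr_wpDl.
have small (P : prob) : \forall N \near \oo, P (F N) < (e / (D + 1))%:E.
  have /fine_cvgP[fF /cvgrPdist_lt/(_ _ De0)] := F0 P.
  move=> H; near=> N.
  have : (`|0 - fine (P (F N))| < e / (D + 1))%R by near: N.
  rewrite sub0r normrN ger0_norm ?fine_ge0// => h.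
  by rewrite -lte_fin fineK// in h; near: N.
have [N [F1 F2]] : exists N, P1 (F N) < (e / (D + 1))%:E /\ P2 (F N) < (e / (D + 1))%:E.
  near \oo => N; exists N; split; near: N; exact: small.
pose S x : 'I_N.+1 := inord (minn (first x) N).
have SE x : S x = minn (first x) N :> nat.
  by rewrite inordK// ltnS geq_minr.
pose delta (i : 'I_N.+1) := if (i < N)%N then e else D.
have delta0 i : (0 <= delta i)%R by rewrite /delta; case: ifP => // _; exact: ltW.
have bound (P : prob) : P (F N) < (e / (D + 1))%:E ->
    \int[P]_x (delta (S x))%:E <= eps%:E.
  move=> PF; apply: (@le_trans _ _ (\int[P]_x (e%:E + D%:E * (\1_(F N) x)%:E))).
    apply: ge0_le_integralT => x; first by rewrite lee_fin.
    rewrite -EFinM -EFinD lee_fin /delta SE indicE.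
    case: ifPn => Sx; first by rewrite lerDl mulr_ge0.
    rewrite mem_set ?mulr1 ?lerDr ?ltW//.
    by rewrite /F/= leqNgt; apply: contra Sx => ?; rewrite (minn_idPl _)// ltnW.
  have mF1 : measurable_fun setT (fun x : borelType X => (\1_(F N) x)%:E : \bar R).
    apply/measurable_EFinP; apply: measurable_indic; exact: mfirst.
  rewrite ge0_integralD//; last 3 first.
  - by move=> x _; rewrite lee_fin ltW.
  - by move=> x _; rewrite -EFinM lee_fin mulr_ge0.
  - exact: emeasurable_funM.
  rewrite integral_cst// ge0_integralZl//.
  rewrite integral_indic ?setIT//; last exact: mfirst.
  rewrite [X in e%:E * X]probability_setT mule1.
  apply: (@le_trans _ _ (e%:E + D%:E * (e / (D + 1))%:E)).
    by rewrite leeD2l// lee_wpmul2l ?lee_fin// ltW.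
  rewrite -EFinM -EFinD lee_fin (_ : eps = e + e)%R; last by rewrite /e; field.
  rewrite lerD2l mulrCA ger_pMr// ler_pdivrMr ?ltr_wpDl//; lra.
exists N.+1, S, (a \o @nat_of_ord _), delta; split => //.
- move=> i; rewrite (_ : _ @^-1` _ = first @^-1` [set k | minn k N = i]).
    exact: mfirst.
  apply/seteqP; split => x /=; first by move=> <-; rewrite SE.
  by move=> h; apply/val_inj; rewrite /= SE.
- move=> x; rewrite /delta /= SE; case: ifPn => // Sx.
  rewrite (minn_idPl _); first exact/ltW/firstP.
  by move: Sx; rewrite ltnNge leq_min leqnn andbT -ltnNge => /ltnW.
- exact: bound.
- exact: bound.
Unshelve. all: by end_near. Qed.

Lemma fibers_total (P : prob) n (S : borelType X -> 'I_n) :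
  (forall i, measurable (S @^-1` [set i])) ->
  (\sum_i fine (P (S @^-1` [set i])) = 1)%R.
Proof.
move=> mS; apply: EFin_inj; rewrite -sumEFin -(probability_setT P).
rewrite (measure_fibers P mS measurableT); apply: eq_bigr => i _.
by rewrite setTI fineK// fin_num_measure.
Qed.

(** The greatest 1-Lipschitz function with [f (rep j) <= - v j] for all [j], namely
    the infimum over [j] of [d(x, rep j) - v j].  It can only improve the prices:
    it dominates [u] whenever [u i + v j <= d(rep i, rep j)]. *)
Lemma mcshane n (rep : 'I_n.+1 -> X) (v : 'I_n.+1 -> R) : exists f : X -> R,
  [/\ forall x, (- \sum_j `|v j| <= f x)%R,
      forall x y, (f x <= mdist x y + f y)%R,
      forall j, (f (rep j) <= - v j)%R &
      forall z x, (forall j, z <= mdist x (rep j) - v j)%R -> (z <= f x)%R].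
Proof.
pose E x := [set (mdist x (rep j) - v j)%R | j in [set: 'I_n.+1]].
have E0 x : E x !=set0 by exists (mdist x (rep ord0) - v ord0)%R, ord0.
have Elb x : lbound (E x) (- \sum_j `|v j|)%R.
  move=> _ [j _ <-]; have := mdist_ge0 x (rep j).
  have : (v j <= \sum_j `|v j|)%R.
    rewrite (le_trans (ler_norm _))// (bigD1 j)//= lerDl.
    by apply: sumr_ge0 => k _; exact: normr_ge0.
  by lra.
have Einf x : has_inf (E x) by split => //; exists (- \sum_j `|v j|)%R.
have infE x j : (inf (E x) <= mdist x (rep j) - v j)%R.
  by apply: ge_inf; [exact: (Einf x).2|exists j].
exists (fun x => inf (E x)); split.
- by move=> x; exact: lb_le_inf.
- move=> x y; rewrite -lerBlDl; apply: lb_le_inf => // _ [j _ <-].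
  have := infE x j; have := metric_triangle x y (rep j); lra.
- by move=> j; have := infE (rep j) j; rewrite mdistxx sub0r.
- by move=> z x H; apply: lb_le_inf => // _ [j _ <-].
Qed.

(** Kantorovich duality, up to an arbitrarily small error: solve the discretized
    problem, lift its optimal plan to a coupling and extend its optimal prices
    to a Lipschitz function. *)
Theorem kantorovich (P1 P2 : prob) (eps : R) : (0 < eps)%R ->
  exists f : X -> R, [/\ forall x, (0 <= f x)%R, exists M, forall x, (f x <= M)%R,
    forall x y, (f x <= mdist x y + f y)%R &
    W P1 P2 + \int[P2]_x (f x)%:E <= \int[P1]_x (f x)%:E + eps%:E].
Proof.
(* Five errors of size e add up: two in the transport from the points to the
   representatives, two when f is evaluated at the representatives, and one in
   the finite duality. *)
move=> eps0; pose e := (eps / 5)%R; have e0 : (0 < e)%R by rewrite divr_gt0.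
have [n [S [rep [delta [mS delta0 dS S1 S2]]]]] := discretization P1 P2 e0.
(* The space is not empty, hence there is at least one cell. *)
case: n S rep delta mS delta0 dS S1 S2 => [S|n S rep delta mS delta0 dS S1 S2].
  by have [] := S point.
pose a i := fine (P1 (S @^-1` [set i])).
pose b i := fine (P2 (S @^-1` [set i])).
have a0 i : (0 <= a i)%R by exact: fine_ge0.
have b0 i : (0 <= b i)%R by exact: fine_ge0.
have aE i : P1 (S @^-1` [set i]) = (a i)%:E by rewrite fineK// fin_num_measure.
have bE i : P2 (S @^-1` [set i]) = (b i)%:E by rewrite fineK// fin_num_measure.
have intP1 (h : 'I_n.+1 -> R) : (forall i, 0 <= h i)%R ->
    \int[P1]_x (h (S x))%:E = (\sum_i h i * a i)%:E.
  move=> h0; rewrite integral_fibers// -sumEFin.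
  by apply: eq_bigr => i _; rewrite [RHS]EFinM; congr (_ * _); exact: aE.
have intP2 (h : 'I_n.+1 -> R) : (forall i, 0 <= h i)%R ->
    \int[P2]_x (h (S x))%:E = (\sum_i h i * b i)%:E.
  move=> h0; rewrite integral_fibers// -sumEFin.
  by apply: eq_bigr => i _; rewrite [RHS]EFinM; congr (_ * _); exact: bE.
have [m [m0 mrow mcol mdual]] := finite_duality a0 b0 (fibers_total P1 mS)
  (fibers_total P2 mS) (\matrix_(i, j) mdist (rep i) (rep j)).
have [u [v [uv cost]]] := mdual _ e0.
have [g cg gE] := coupling_lift mS m0 mrow mcol.
have [f0 [f0lb f0lip f0rep f0max]] := mcshane rep v.
(* Adding K makes f nonnegative without changing differences of integrals. *)
pose K := (\sum_j `|v j|)%R; pose f x := (f0 x + K)%R.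
have f_ge0 x : (0 <= f x)%R by have := f0lb x; rewrite /f /K; lra.
have flip x y : (f x <= mdist x y + f y)%R by have := f0lip x y; rewrite /f; lra.
exists f; split => //.
  have [D dD] := bdX; exists (D + f point)%R => x.
  by rewrite (le_trans (flip x point))// lerD2r.
have mf : measurable_fun setT (fun x : borelType X => (f x)%:E).
  by apply/measurable_EFinP; apply: continuous_borel; exact: lipschitz_continuous.
have mh (h : 'I_n.+1 -> R) : measurable_fun setT (fun x => (h (S x))%:E).
  by apply/measurable_EFinP; exact: measurable_fibers.
have W_le : W P1 P2 <= (\sum_i delta i * a i + \sum_i delta i * b i +
    \sum_i \sum_j m i j * mdist (rep i) (rep j))%:E.
  apply: ge_ereal_inf; exists (\int[g]_z (mdist (z.1 : X) z.2)%:E); first by exists g.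
  pose c (ij : 'I_n.+1 * 'I_n.+1) := mdist (rep ij.1) (rep ij.2).
  apply: (@le_trans _ _ (\int[g]_z ((delta (S z.1))%:E + (delta (S z.2))%:E +
      (c (S z.1, S z.2))%:E))).
    apply: ge0_le_integralT => -[x y] /=; first by rewrite lee_fin mdist_ge0.
    rewrite -!EFinD lee_fin /c/=.
    have := metric_triangle x (rep (S x)) y; have := dS x; have := dS y.
    have := metric_triangle (rep (S x)) (rep (S y)) y.
    by rewrite (metric_sym (rep (S y)) y); lra.
  have mfib (ij : 'I_n.+1 * 'I_n.+1) :
      measurable ((fun z => (S z.1, S z.2)) @^-1` [set ij]).
    rewrite (_ : _ @^-1` _ = (S @^-1` [set ij.1]) `*` (S @^-1` [set ij.2])).
      exact: measurableX.
    by case: ij => i j; apply/seteqP; split => -[x y] /= [-> ->].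
  have md1 : measurable_fun setT (fun z : borelType X * borelType X => (delta (S z.1))%:E).
    exact: measurableT_comp (mh delta) measurable_fst.
  have md2 : measurable_fun setT (fun z : borelType X * borelType X => (delta (S z.2))%:E).
    exact: measurableT_comp (mh delta) measurable_snd.
  rewrite ge0_integralD//; first last.
  - by apply/measurable_EFinP; exact: measurable_fibers.
  - by move=> z _; rewrite lee_fin mdist_ge0.
  - exact: emeasurable_funD.
  - by move=> z _; rewrite -EFinD lee_fin addr_ge0.
  rewrite ge0_integralD//; [|by move=> z _; rewrite lee_fin..].
  rewrite (coupling_integral1 cg (mh delta)); last by move=> x; rewrite lee_fin.
  rewrite (coupling_integral2 cg (mh delta)); last by move=> x; rewrite lee_fin.
  rewrite intP1// intP2//.
  rewrite (integral_fibers _ mfib); last by move=> ij; exact: mdist_ge0.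
  rewrite !EFinD leeD2l// le_eqVlt; apply/predU1P; left.
  rewrite pair_bigA -sumEFin; apply: eq_bigr => -[i j] _ /=.
  rewrite muleC [RHS]EFinM; congr (_ * _); rewrite -gE; congr (g _).
  by apply/seteqP; split => -[x y] /= [-> ->].
have Af : (\sum_i f (rep i) * a i)%:E <= \int[P1]_x (f x)%:E + e%:E.
  rewrite -(intP1 (f \o rep)) => [|i]; last exact: f_ge0.
  apply: (@le_trans _ _ (\int[P1]_x ((f x)%:E + (delta (S x))%:E))).
    apply: ge0_le_integralT => x; first by rewrite lee_fin /=.
    rewrite -EFinD lee_fin/=; have := flip (rep (S x)) x; have := dS x.
    by rewrite metric_sym; lra.
  rewrite ge0_integralD//; [|by move=> x _; rewrite lee_fin..].
  exact: leeD2l.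
have Bf : \int[P2]_x (f x)%:E <= (\sum_i f (rep i) * b i)%:E + e%:E.
  rewrite -(intP2 (f \o rep)) => [|i]; last exact: f_ge0.
  apply: (@le_trans _ _ (\int[P2]_x ((f (rep (S x)))%:E + (delta (S x))%:E))).
    apply: ge0_le_integralT => x; first by rewrite lee_fin /=.
    by rewrite -EFinD lee_fin/=; have := flip x (rep (S x)); have := dS x; lra.
  rewrite ge0_integralD//; [|by move=> x _; rewrite lee_fin|exact: (mh (f \o rep))
    |by move=> x _; rewrite lee_fin].
  exact: leeD2l.
have dual : (dual_value a b u v <=
    \sum_i f (rep i) * a i - \sum_j f (rep j) * b j)%R.
  have fE (w : 'I_n.+1 -> R) : (\sum_i w i = 1 ->
      \sum_i f (rep i) * w i = \sum_i f0 (rep i) * w i + K)%R.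
    move=> w1; rewrite -[X in (_ + X)%R]mulr1 -w1 mulr_sumr -big_split.
    by apply: eq_bigr => i _; rewrite /= -mulrDl.
  rewrite !fE; [|exact: fibers_total..].
  have : (\sum_i u i * a i <= \sum_i f0 (rep i) * a i)%R.
    apply: ler_sum => i _; rewrite ler_wpM2r//; apply: f0max => j.
    by have := uv i j; rewrite mxE; lra.
  have : (\sum_j v j * b j <= - \sum_j f0 (rep j) * b j)%R.
    rewrite -sumrN; apply: ler_sum => j _; rewrite -mulNr ler_wpM2r//.
    by have := f0rep j; lra.
  by rewrite /dual_value; lra.
have Sa : (\sum_i delta i * a i <= e)%R by rewrite -lee_fin -intP1.
have Sb : (\sum_i delta i * b i <= e)%R by rewrite -lee_fin -intP2.
have {}cost : (\sum_i \sum_j m i j * mdist (rep i) (rep j) <=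
    dual_value a b u v + e)%R.
  apply: le_trans cost; rewrite le_eqVlt; apply/predU1P; left.
  by apply: eq_bigr => i _; apply: eq_bigr => j _; rewrite mxE.
apply: (le_trans (leeD W_le Bf)).
rewrite (_ : eps = e + 4 * e)%R; last by rewrite /e; field.
have := leeD2r (4 * e)%:E Af; rewrite -addeA -EFinD; apply: le_trans.
rewrite -!EFinD lee_fin; lra.
Qed.

End kantorovich.

Local Close Scope ereal_scope.

(** * The laws of the sticks *)

Section beta.
Context (R : realType).
Local Notation leb := (@lebesgue_measure R).

Lemma is_derive_powR1B (c y : R) : y < 1 ->
  is_derive y 1 (fun x => (1 - x) `^ c) (- (c * (1 - y) `^ (c - 1))).
Proof.
move=> y1; have y1' : 0 < 1 - y by rewrite subr_gt0.
have H := is_derive1_powR c y1'.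
have := @is_derive1_comp R (fun x => x `^ c) (fun x => 1 - x) y _ _ H.
move=> /(_ (-1)); rewrite mulrN1; apply.
by apply: is_derive_eq; rewrite add0r mul1r.
Qed.

Lemma continuous_powR1B (c y : R) : y < 1 ->
  {for y, continuous (fun x : R => (1 - x) `^ c : R)}.
Proof.
move=> y1; have [dy _] := is_derive_powR1B c y1.
by apply: differentiable_continuous; apply/derivable1_diffP.
Qed.

Lemma integral_powR1B (alpha b : R) : 0 < alpha -> 0 < b < 1 ->
  (\int[leb]_(x in `[0%R, b]) ((1 - x) `^ (alpha - 1))%:E =
   ((1 - (1 - b) `^ alpha) / alpha)%:E)%E.
Proof.
move=> a0 /andP[b0 b1].
pose F (x : R) : R := - alpha^-1 * (1 - x) `^ alpha.
have dF (y : R) : y < 1 -> is_derive y 1 F ((1 - y) `^ (alpha - 1)).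
  move=> y1; have dy := is_derive_powR1B alpha y1.
  apply: is_derive_eq; rewrite /GRing.scale/=; field; exact: lt0r_neq0.
have cF (y : R) : y < 1 -> {for y, continuous F}.
  move=> y1; have [dy _] := dF _ y1.
  by apply: differentiable_continuous; apply/derivable1_diffP.
rewrite (@continuous_FTC2 _ _ F)//.
- rewrite -EFinB; congr _%:E; rewrite /F subr0 powR1; field; exact: lt0r_neq0.
- apply: continuous_in_subspaceT => y; rewrite inE/= in_itv/= => /andP[_ yb].
  exact/continuous_powR1B/(le_lt_trans yb).
- split.
  + by move=> y; rewrite in_itv/= => /andP[_ yb]; have [] := dF y (lt_trans yb b1).
  + by apply: cvg_at_right_filter; exact: cF.
  + by apply: cvg_at_left_filter; exact: cF.
- move=> y; rewrite in_itv/= => /andP[_ yb].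
  by have dy := dF y (lt_trans yb b1); rewrite derive1E derive_val.
Qed.

Variables (alpha : R) (alpha_gt0 : 0 < alpha).

Let h (x : R) : R := x `^ (1 - 1) * (1 - x) `^ (alpha - 1).

Let hE x : 0 < x -> h x = (1 - x) `^ (alpha - 1).
Proof. by rewrite /h subrr powRr0 mul1r. Qed.

Let h_ge0 x : 0 <= h x.
Proof. by rewrite mulr_ge0 ?powR_ge0. Qed.

Let mh D : measurable_fun D h.
Proof.
apply: measurable_funTS; apply: measurable_funM; first exact: measurable_powR.
apply: (@measurableT_comp _ _ _ _ _ _ (@powR R ^~ (alpha - 1))).
  exact: measurable_powR.
exact: measurable_funB.
Qed.

Local Notation I01 := (`]0%R, 1%R[%classic : set R).

(** Up to [c n] the density is bounded and the fundamental theorem of calculus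
    applies; at 1 it may be unbounded.  The denominator [n + 2] keeps [c n]
    positive. *)
Let c n : R := 1 - n.+2%:R^-1.

Let c01 n : 0 < c n < 1.
Proof.
by rewrite /c subr_gt0 ltrBlDr ltrDl invr_gt0 ltr0n andbT invf_lt1 ?ltr0n// ltr1n.
Qed.

Let int0b b : 0 < b < 1 -> (\int[leb]_(x in `]0%R, b]) (h x)%:E =
  ((1 - (1 - b) `^ alpha) / alpha)%:E)%E.
Proof.
move=> b01.
rewrite -integral_powR1B// -[RHS]integral_itv_obnd_cbnd; last first.
  apply/measurable_EFinP; apply: (@measurableT_comp _ _ _ _ _ _ (@powR R ^~ (alpha - 1))).
    exact: measurable_powR.
  exact: measurable_funB.
apply: eq_integral => x; rewrite inE/= in_itv/= => /andP[x0 _].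
by rewrite hE.
Qed.

Let I01E : I01 = \bigcup_n `]0, c n]%classic.
Proof.
apply/seteqP; split => [x|x [n _]] /=; rewrite !in_itv/= => /andP[x0 x1].
  exists (Num.truncn (1 - x)^-1) => //=; rewrite in_itv/= x0/=.
  have x1' : 0 < 1 - x by rewrite subr_gt0.
  rewrite lerBrDl -lerBrDr -[leRHS]invrK lef_pV2 ?posrE ?invr_gt0//.
  have := truncnS_gt (1 - x)^-1.
  move=> /ltW /le_trans; apply; rewrite ler_nat//.
by rewrite x0/= (le_lt_trans x1)//; case/andP: (c01 n).
Qed.

Let int01 : exists2 K : R, 0 < K & (\int[leb]_(x in I01) (h x)%:E = K%:E)%E.
Proof.
have cvgI : (\int[leb]_(x in `]0%R, c n]) (h x)%:E @[n --> \oo] -->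
    \int[leb]_(x in I01) (h x)%:E)%E.
  rewrite I01E; apply: ge0_nondecreasing_set_cvg_integral => //.
  - move=> m n mn; apply/subsetPset => x /=; rewrite !in_itv/= => /andP[-> xm]/=.
    rewrite (le_trans xm)// lerD2l lerN2 lef_pV2 ?posrE ?ltr0n// ler_nat.
    by rewrite !ltnS.
  - by move=> n; apply/measurable_EFinP; exact: mh.
  - by move=> n x _; rewrite lee_fin.
have le_lim : (\int[leb]_(x in I01) (h x)%:E <= (alpha^-1)%:E)%E.
  rewrite -(cvg_lim _ cvgI)//; apply: lime_le; first by apply/cvg_ex; eexists; exact: cvgI.
  apply: nearW => n; rewrite int0b// lee_fin -[leRHS]mul1r ler_pM2r ?invr_gt0//.
  by rewrite gerBl powR_ge0.
have lim_gt0 : (0 < \int[leb]_(x in I01) (h x)%:E)%E.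
  apply: (@lt_le_trans _ _ (\int[leb]_(x in `]0%R, c 0%N]) (h x)%:E)%E).
    rewrite int0b// lte_fin divr_gt0// subr_gt0.
    have /andP[c0 c1] := c01 0.
    rewrite -[ltRHS]/((fun=> 1) alpha) -powR1.
    by rewrite gt0_ltr_powR ?nnegrE ?ltrBlDr ?ltrDl// subr_ge0 ltW.
  apply: ge0_subset_integral => //.
  - by apply/measurable_EFinP; exact: mh.
  - by move=> x _; rewrite lee_fin.
  - by rewrite I01E => x cx; exists 0%N.
have If : (\int[leb]_(x in I01) (h x)%:E)%E \is a fin_num.
  by rewrite ge0_fin_numE ?(le_lt_trans le_lim) ?ltry// ltW.
exists (fine (\int[leb]_(x in I01) (h x)%:E)%E); last by rewrite fineK.
by rewrite fine_gt0// lim_gt0 -ge0_fin_numE// ltW.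
Qed.

Let density x : R := h x / euler_beta 1 alpha.

Let density_ge0 x : 0 <= density x.
Proof.
have [K K0 KE] := int01.
by rewrite divr_ge0// /euler_beta /Rintegral -/(h _) KE /= ltW.
Qed.

Let mdensity D : measurable_fun D density.
Proof. exact: measurable_funM. Qed.

(** A probability, because the integral [euler_beta 1 alpha] by which the density
    is divided is finite and positive. *)
Definition stick_law : set R -> \bar R := beta_law 1 alpha.

Let stick_law0 : stick_law set0 = 0%E.
Proof. by rewrite /stick_law /beta_law set0I integral_set0. Qed.

Let stick_law_ge0 A : (0 <= stick_law A)%E.
Proof. by apply: integral_ge0 => x _; rewrite lee_fin; exact: density_ge0. Qed.

Let stick_law_sigma_additive : semi_sigma_additive stick_law.
Proof.
move=> F mF tF mUF; rewrite /stick_law /beta_law setI_bigcupl.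
rewrite ge0_integral_bigcup//.
- by apply: is_cvg_nneseries => n _ _; exact: stick_law_ge0.
- by move=> n; apply: (@measurableI _ R); [exact: mF|exact: measurable_itv].
- by apply/measurable_EFinP; exact: mdensity.
- by move=> x _; rewrite lee_fin; exact: density_ge0.
- exact: trivIset_setIr.
Qed.

HB.instance Definition _ := isMeasure.Build _ _ _ stick_law
  stick_law0 stick_law_ge0 stick_law_sigma_additive.

Let stick_lawT : stick_law setT = 1%E.
Proof.
have [K K0 KE] := int01.
rewrite /stick_law /beta_law setTI.
under eq_integral do rewrite EFinM.
rewrite ge0_integralZr//; last 3 first.
- by apply/measurable_EFinP; exact: mh.
- by move=> x _; rewrite lee_fin; exact: h_ge0.
- by rewrite lee_fin invr_ge0 /euler_beta /Rintegral -/(h _) KE /= ltW.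
rewrite /euler_beta /Rintegral KE /= -EFinM divff//; exact: lt0r_neq0.
Qed.

HB.instance Definition _ := Measure_isProbability.Build _ _ _ stick_law stick_lawT.

Definition stick_prob : probability R R := stick_law.

Lemma stick_prob01 : stick_prob (~` I01) = 0%E.
Proof.
by rewrite /stick_prob/= /stick_law /beta_law setICl integral_set0.
Qed.

(** The distribution function is [1 - (1 - b) ^ alpha] up to a constant, hence
    strictly increasing; that [b] lies strictly below a [b'] still below 1
    spares the value of the constant. *)
Lemma stick_prob_lt1 (b : R) : 0 < b < 1 -> (stick_prob `]-oo, b]%classic < 1)%E.
Proof.
have [K K0 KE] := int01.
have cdf (a : R) : 0 < a < 1 ->
    stick_prob `]-oo, a]%classic = ((1 - (1 - a) `^ alpha) / alpha * K^-1)%:E.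
  move=> /[dup] a01 /andP[a0 a1].
  rewrite EFinM -int0b// /stick_prob/= /stick_law /beta_law.
  rewrite (_ : _ `&` _ = `]0, a]%classic); last first.
    apply/seteqP; split => x /=; rewrite !in_itv/=.
      by move=> [xa /andP[-> _]].
    by move=> /andP[-> xa]; split => //; exact: le_lt_trans a1.
  under eq_integral do rewrite EFinM.
  rewrite ge0_integralZr//=; last 3 first.
  - by apply/measurable_EFinP; exact: mh.
  - by move=> x _; rewrite lee_fin; exact: h_ge0.
  - by rewrite lee_fin invr_ge0 /euler_beta /Rintegral -/(h _) KE /= ltW.
  by rewrite /euler_beta /Rintegral KE.
move=> /[dup] b01 /andP[b0 b1]; pose b' := (b + 1) / 2.
have b'01 : 0 < b' < 1 by rewrite /b'; apply/andP; split; lra.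
apply: (@lt_le_trans _ _ (stick_prob `]-oo, b']%classic)); last exact: probability_le1.
rewrite !cdf// lte_fin !ltr_pM2r ?invr_gt0// ltrD2l ltrN2 gt0_ltr_powR//.
- by rewrite nnegrE /b'; lra.
- by rewrite nnegrE; lra.
- by rewrite /b'; lra.
Qed.

End beta.

(** * Stick breaking *)

Section weights.
Context (R : realType).

Record weights := Weights {
  wt :> nat -> R ;
  wt_ge0 : forall i, 0 <= wt i ;
  wt_sum : (\sum_(0 <= i <oo) (wt i)%:E = 1)%E }.

Program Definition unit_weights : weights := @Weights (fun i => (i == 0%N)%:R) _ _.
Next Obligation. by []. Qed.
Next Obligation.
rewrite nneseries_recl// eseries0 ?adde0// => i i0 _.
by rewrite gtn_eqF.
Qed.

(** The length of the stick left after [n] breaks. *)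
Definition remaining (v : nat -> R) n : R := \prod_(j < n) (1 - v j).

(** The stick is used up, expressed by countably many conditions to make
    measurability plain.  Thresholds start at 1/2 because [1 - 1/k.+2] must be
    positive in [proper_sticks_ae]. *)
Definition proper_sticks (v : nat -> R) : Prop :=
  (forall i, 0 <= v i <= 1) /\ forall k, exists n, remaining v n < k.+2%:R^-1.

(** The sum telescopes. *)
Lemma sum_sticks (v : nat -> R) n :
  \sum_(i < n) v i * \prod_(j < i) (1 - v j) = 1 - remaining v n.
Proof.
elim: n => [|n IH]; first by rewrite /remaining !big_ord0 subrr.
rewrite big_ord_recr IH /remaining big_ord_recr/=; ring.
Qed.

Lemma remaining_ge0 v n : (forall i, 0 <= v i <= 1) -> 0 <= remaining v n.
Proof.
by move=> v01; apply: prodr_ge0 => i _; rewrite subr_ge0; case/andP: (v01 i).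
Qed.

Lemma remaining_le v m n : (forall i, 0 <= v i <= 1) -> (m <= n)%N ->
  remaining v n <= remaining v m.
Proof.
move=> v01; elim: n => [|n IH]; first by rewrite leqn0 => /eqP->.
rewrite leq_eqVlt => /predU1P[->//|]; rewrite ltnS => /IH; apply: le_trans.
rewrite /remaining big_ord_recr/= ler_piMr//; first exact: remaining_ge0.
by rewrite lerBlDr lerDl; case/andP: (v01 n).
Qed.

Lemma remaining_le1 v n : (forall i, 0 <= v i <= 1) -> remaining v n <= 1.
Proof.
by move=> v01; rewrite (le_trans (remaining_le v01 (leq0n n)))// /remaining big_ord0.
Qed.

Lemma remaining_cvg v : proper_sticks v -> remaining v n @[n --> \oo] --> (0 : R).
Proof.
move=> [v01 v0]; apply/cvgrPdist_lt => e e0.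
have [n vn] := v0 (Num.truncn e^-1).
near=> m.
rewrite sub0r normrN ger0_norm ?remaining_ge0//.
apply: (@le_lt_trans _ _ (remaining v n)).
  by apply: remaining_le => //; near: m; exists n.
rewrite (lt_trans vn)// -[ltRHS]invrK ltf_pV2 ?posrE ?invr_gt0//.
by rewrite (lt_trans (truncnS_gt _))// ltr_nat.
Unshelve. all: by end_near. Qed.

Lemma sum_proper_sticks v : proper_sticks v ->
  (\sum_(0 <= i <oo) (v i * \prod_(j < i) (1 - v j))%:E = 1)%E.
Proof.
move=> pv; apply/cvg_lim => //.
rewrite (_ : (fun n => _) = fun n => (1 - remaining v n)%:E); last first.
  by apply/funext => n; rewrite big_mkord sumEFin sum_sticks.
apply: cvg_EFin; first exact: nearW.
rewrite -[X in _ --> X]subr0; apply: cvgB; first exact: cvg_cst.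
exact: remaining_cvg.
Qed.

(** The weights obtained by breaking the sticks [v]; a default value is used on
    the null set of sequences that do not exhaust the unit stick. *)
Definition stick_weight (v : nat -> R) : nat -> R :=
  if `[< proper_sticks v >] then fun i => v i * \prod_(j < i) (1 - v j)
  else unit_weights.

Program Definition stick_weights (v : nat -> R) : weights :=
  @Weights (stick_weight v) _ _.
Next Obligation.
move=> v i; rewrite /stick_weight.
case: (asboolP (proper_sticks v)) => [[v01 _]|_]; last exact: wt_ge0.
apply: mulr_ge0; first by case/andP: (v01 i).
exact: (remaining_ge0 i v01).
Qed.
Next Obligation.
move=> v; rewrite /stick_weight.
case: (asboolP (proper_sticks v)) => [pv|_]; last exact: wt_sum.
exact: sum_proper_sticks.
Qed.

Arguments stick_weights : simpl never.

Lemma stick_weightsE v i : proper_sticks v ->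
  stick_weights v i = v i * \prod_(j < i) (1 - v j).
Proof. by rewrite /stick_weights/= /stick_weight => /asboolT ->. Qed.

Local Notation sticks := (seqspace R).

Lemma measurable_remaining n : measurable_fun setT (fun v : sticks => remaining v n).
Proof.
apply: measurable_prod => i _; apply: measurable_funB => //.
exact: measurable_coord.
Qed.

Lemma measurable_proper_sticks : measurable [set v : sticks | proper_sticks v].
Proof.
rewrite (_ : [set v | _] = (\bigcap_i (fun v : sticks => v i) @^-1` `[0, 1]) `&`
    \bigcap_k \bigcup_n (fun v : sticks => remaining v n) @^-1` `]-oo, k.+2%:R^-1[).
  apply: measurableI.
    apply: bigcapT_measurable => i; rewrite -[X in measurable X]setTI.
    exact: measurable_coord.
  apply: bigcapT_measurable => k; apply: bigcupT_measurable => n.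
  have mr := measurable_remaining n.
  by rewrite -[X in measurable X]setTI; apply: mr => //; exact: measurable_itv.
apply/seteqP; split => v /=.
  move=> [v01 v0]; split => [i _|k _] /=; first by rewrite in_itv/= v01.
  by have [n vn] := v0 k; exists n => //=; rewrite in_itv.
move=> [v01 v0]; split => [i|k].
  by have := v01 i I; rewrite /= in_itv.
by have [n _] := v0 k I; rewrite /= in_itv/=; exists n.
Qed.

Lemma measurable_stick_weights i :
  measurable_fun setT (fun v : sticks => stick_weights v i).
Proof.
rewrite (_ : (fun v => _) = fun v : sticks => if `[< proper_sticks v >]
    then v i * remaining v i else unit_weights i); last first.
  by apply/funext => v; rewrite /stick_weights/= /stick_weight; case: ifP.
apply: measurable_fun_ifT => //.
  apply: (measurable_fun_bool true).
  rewrite setTI (_ : _ @^-1` _ = [set v : sticks | proper_sticks v]).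
    exact: measurable_proper_sticks.
  by apply/seteqP; split => v /asboolP.
apply: measurable_funM; [exact: measurable_coord|exact: measurable_remaining].
Qed.

Variables (alpha : R) (alpha_gt0 : 0 < alpha).
Local Notation P := (iid_prob (stick_prob alpha_gt0)).

(** If a fraction [r] of the stick is never used, then no break exceeds [1 - r],
    since the length left after a break is at most one minus that break.  By
    independence the probability of this event is at most [q ^ n] for all [n],
    with [q < 1]. *)
Lemma proper_sticks_ae : P.-negligible [set v | ~ proper_sticks v].
Proof.
pose A := \bigcup_i (fun v : sticks => v i) @^-1` (~` `]0, 1[).
pose B r : set sticks := \bigcap_i (fun v : sticks => v i) @^-1` `]-oo, 1 - r].
apply: (@negligibleS _ _ _ _ (A `|` \bigcup_k B k.+2%:R^-1)).
  move=> v /= npv; apply: contrapT => /not_orP[nA nB]; apply: npv.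
  have v01 i : 0 < v i < 1.
    by apply: contrapT => vi; apply: nA; exists i => //=; rewrite in_itv.
  have v01' i : 0 <= v i <= 1 by case/andP: (v01 i) => /ltW -> /ltW ->.
  split => // k; apply: contrapT => /forallNP H; apply: nB; exists k => // i _ /=.
  rewrite in_itv/= lerBrDl -lerBrDr.
  have /negP := H i.+1; rewrite -leNgt => /le_trans; apply.
  rewrite /remaining big_ord_recr/= ler_piMl ?remaining_le1//.
  by rewrite subr_ge0; case/andP: (v01' i).
apply: negligibleU; apply: negligible_bigcup => k.
  have mk : measurable ((fun v : sticks => v k) @^-1` (~` `]0, 1[)).
    rewrite -[X in measurable X]setTI; apply: measurable_coord => //.
    by apply: measurableC; exact: measurable_itv.
  apply/negligibleP => //.
  have := iid_prob_cap (stick_prob alpha_gt0) (s := [:: k]) (B := fun=> ~` `]0, 1[) isT.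
  rewrite big_seq1 => H.
  transitivity (stick_prob alpha_gt0 (~` `]0, 1[)); last exact: stick_prob01.
  rewrite -H//; last by move=> i; apply: measurableC; exact: measurable_itv.
    congr (P _); apply/seteqP; split => v /=; first by move=> vk i /=; rewrite inE => /eqP->.
  by move=> /(_ k); rewrite /= inE eqxx; apply.
set r := _^-1; have r01 : 0 < r < 1.
  by rewrite /r invr_gt0 ltr0n invf_lt1// ltr1n.
have /andP[r0 r1] := r01.
have mB : measurable (B r).
  apply: bigcapT_measurable => i; rewrite -[X in measurable X]setTI.
  exact: measurable_coord.
apply/negligibleP => //; apply/eqP; rewrite eq_le measure_ge0 andbT.
pose q := fine (stick_prob alpha_gt0 `]-oo, 1 - r]%classic).
have qE : stick_prob alpha_gt0 `]-oo, 1 - r]%classic = q%:E.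
  by rewrite fineK// fin_num_measure.
have q0 : 0 <= q by exact: fine_ge0.
have q1 : q < 1 by rewrite -lte_fin -qE; apply: stick_prob_lt1; apply/andP; split; lra.
have Bn n : (P (B r) <= (q ^+ n)%:E)%E.
  apply: (@le_trans _ _ (P (box n (fun=> `]-oo, 1 - r]%classic)))).
    apply: le_measure; rewrite ?inE//; first exact: measurable_box.
    by move=> v Bv i _; exact: Bv.
  by rewrite iid_prob_box// (eq_bigr (fun=> q%:E))// prodEFin prodr_const card_ord.
have qn : (q ^+ n)%:E @[n --> \oo] --> (0%:E : \bar R).
  by apply: cvg_EFin; [exact: nearW|apply: cvg_expr; rewrite ger0_norm].
apply: (@le_trans _ _ (limn (fun n => (q ^+ n)%:E))); last by rewrite (cvg_lim _ qn).
apply: lime_ge; first by apply/cvg_ex; eexists; exact: qn.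
exact: nearW.
Qed.

End weights.

Local Open Scope ereal_scope.

Section mixture.
Context d (T : measurableType d) (R : realType) (w : weights R) (z : nat -> T).

Definition mixture : set T -> \bar R :=
  mseries (fun i => mscale (NngNum (wt_ge0 w i)) (dirac (z i))) 0.

HB.instance Definition _ := Measure.on mixture.

Lemma mixtureE A : mixture A = \sum_(0 <= i <oo) (w i)%:E * \d_(z i) A.
Proof. by []. Qed.

Let mixtureT : mixture setT = 1.
Proof.
rewrite mixtureE -(wt_sum w); apply: eq_eseriesr => i _.
by rewrite diracT mule1.
Qed.

HB.instance Definition _ := Measure_isProbability.Build _ _ _ mixture mixtureT.

Lemma integral_mixture (f : T -> \bar R) : measurable_fun setT f ->
  (forall x, 0 <= f x) ->
  \int[mixture]_x f x = \sum_(0 <= i <oo) (w i)%:E * f (z i).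
Proof.
move=> mf f0; rewrite /mixture ge0_integral_measure_series//.
apply: eq_eseriesr => i _; rewrite ge0_integral_mscale//=.
by rewrite integral_dirac// diracT mul1e.
Qed.

End mixture.

(** * The space of probabilities *)

Section weak_topology.
Context (R : realType) (X : completeMetricType R).
Local Notation prob := (probability (borelType X) R).

(** Open sets are preimages under the map to the integrals of the bounded
    continuous functions, and these integrals depend on the values on Borel sets
    only; the sets that do not separate [p] from [q] form a sigma-algebra. *)
Lemma weakP_indistinguishable (p q : weakP R X) :
  (forall A : set (borelType X), measurable A -> (p : prob) A = (q : prob) A) ->
  forall B : set (borelType (weakP R X)), measurable B -> B p = B q.
Proof.
move=> pq; have pqE : @Cb_integral R X p = @Cb_integral R X q.
  apply/funext => f; rewrite /Cb_integral /Rintegral; congr fine.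
  by apply: eq_measure_integral => A mA _; exact: pq.
suff sub : @measurable _ (borelType (weakP R X)) `<=` [set B | B p = B q].
  by move=> B /sub.
apply: smallest_sub => [|_ [B oB <-]]; last by rewrite /preimage/= pqE.
split => [//|A|F FE].
  by rewrite !setTD /= => AE; rewrite /setC/= AE.
apply/propext; split => -[i _ Fi]; exists i => //.
  by rewrite -[F i q]FE.
by rewrite [F i p]FE.
Qed.

End weak_topology.

Section second_countable.
Context (R : realType) (X : completeMetricType R).
Local Notation prob := (probability (borelType X) R).

Variable a : nat -> X.
Hypothesis da : forall x e, (0 < e)%R -> exists k, (mdist x (a k) < e)%R.

(** The tent with center [a k], height [q] and slope [m], where [c = (k, q, m)].
    There are countably many, and every nonnegative continuous function is the
    supremum of the tents below it. *)
Definition tent (c : nat * rat * nat) (x : X) : R :=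
  Num.max 0%R (ratr c.1.2 - c.2%:R * mdist x (a c.1.1))%R.

Definition tents (l : seq (nat * rat * nat)) (x : X) : R :=
  \big[Num.max/0%R]_(c <- l) tent c x.

Lemma tents_ge0 l x : (0 <= tents l x)%R.
Proof.
rewrite /tents; elim: l => [|c l IH]; first by rewrite big_nil.
by rewrite big_cons le_max IH orbT.
Qed.

Lemma le_tents l c x : c \in l -> (tent c x <= tents l x)%R.
Proof.
rewrite /tents; elim: l => // b l IH; rewrite big_cons inE le_max.
by move=> /predU1P[->|/IH ->]; rewrite ?lexx ?orbT.
Qed.

Lemma tents_le l x (M : R) : (0 <= M)%R -> (forall c, c \in l -> (tent c x <= M)%R) ->
  (tents l x <= M)%R.
Proof.
rewrite /tents => M0; elim: l => [|c l IH] H; first by rewrite big_nil.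
rewrite big_cons ge_max H ?mem_head//= IH// => b bl.
by apply: H; rewrite inE bl orbT.
Qed.

Lemma continuous_mdist (z : X) : continuous (fun x : X => mdist x z).
Proof. by apply: lipschitz_continuous => x y; exact: metric_triangle. Qed.

Lemma continuous_tent c : continuous (tent c : X -> R).
Proof.
move=> x; apply: (@continuous_max _ _ (cst 0%R)
  (fun x => ratr c.1.2 - c.2%:R * mdist x (a c.1.1))%R); first exact: cvg_cst.
apply: cvgB; first exact: cvg_cst.
by apply: cvgM; [exact: cvg_cst|exact: continuous_mdist].
Qed.

Lemma continuous_tents l : continuous (tents l : X -> R).
Proof.
rewrite /tents; elim: l => [|b l IHl] x.
  by under eq_fun do rewrite big_nil; exact: cvg_cst.
under eq_fun do rewrite big_cons.
apply: (@continuous_max _ _ (tent b) (tents l)); last exact: IHl.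
exact: continuous_tent.
Qed.

Lemma measurable_tents l : measurable_fun setT (tents l : borelType X -> R).
Proof. by apply: continuous_borel; exact: continuous_tents. Qed.

Lemma tent_approx (f : X -> R) x (e : R) : continuous f -> (forall x, (0 <= f x)%R) ->
  (0 < e)%R -> exists c, (forall y, (tent c y <= f y)%R) /\ (f x - e < tent c x)%R.
Proof.
move=> cf f0 e0; have e20 : (0 < e / 2)%R by rewrite divr_gt0.
have [r /= r0 fr] : exists2 r : R, (0 < r)%R &
    forall y, (mdist x y < r)%R -> (f x - e / 2 < f y)%R.
  have /cvgrPdist_lt/(_ _ e20) := cf x; move=> /nbhs_ballP[r /= r0 fr].
  exists r => // y xy; have := fr y; rewrite ballEmdist => /(_ xy).
  by rewrite ltr_distlC => /andP[]; lra.
have [q] : exists q : rat, ratr q \in `]f x - e / 2 - e / 4, f x - e / 2[%R.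
  by apply: rat_in_itvoo; lra.
rewrite in_itv/= => /andP[q1 q2].
(* Centers are taken within r / 2 of x; this slope makes the tent vanish at
   distance r / 2 of its center, hence outside the ball where f is large. *)
pose m := (Num.truncn (2 * `|ratr q| / r)%R).+1.
have mq : (2 * `|ratr q : R| / r < m%:R)%R by exact: truncnS_gt.
have m0 : (0 < m%:R :> R)%R by rewrite ltr0n.
have s0 : (0 < Num.min (r / 2) (e / (4 * m%:R)))%R.
  by rewrite lt_min !divr_gt0// mulr_gt0.
have [k] := da x s0; rewrite lt_min => /andP[k1 k2].
exists (k, q, m); split => [y|]; rewrite /tent/=.
  rewrite ge_max f0/=; have [xy|xy] := ltP (mdist x y) r.
    have := fr y xy; have : (0 <= m%:R * mdist y (a k))%R.
      by rewrite mulr_ge0 ?mdist_ge0.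
    lra.
  apply: le_trans (f0 y); rewrite lerBlDr add0r (le_trans (ler_norm _))//.
  have rk : (r / 2 <= mdist y (a k))%R.
    have := metric_triangle x (a k) y; rewrite (metric_sym (a k) y); lra.
  apply: (@le_trans _ _ (m%:R * (r / 2))%R); last by rewrite ler_pM2l.
  move: mq; rewrite ltr_pdivrMr//; lra.
rewrite lt_max; apply/orP; right.
have : (m%:R * mdist x (a k) < e / 4)%R.
  move: k2; rewrite ltr_pdivlMr ?mulr_gt0//; lra.
lra.
Qed.

(** The maxima of the first [n] tents below [f] increase to [f], so monotone
    convergence applies. *)
Lemma tents_approx (f : X -> R) (mu : prob) (r : \bar R) :
  continuous f -> (forall x, (0 <= f x)%R) -> r < \int[mu]_x (f x)%:E ->
  exists l, (forall x, (tents l x <= f x)%R) /\ r < \int[mu]_x (tents l x)%:E.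
Proof.
move=> cf f0 rf.
pose valid c := `[< forall x, (tent c x <= f x)%R >].
pose l n := [seq c <- pmap unpickle (iota 0 n) | valid c].
have lf n x : (tents (l n) x <= f x)%R.
  by apply: tents_le => // c; rewrite mem_filter => /andP[/asboolP].
have nd_l x : nondecreasing_seq (fun n => (tents (l n) x)%:E).
  move=> m n mn; rewrite lee_fin; apply: tents_le; first exact: tents_ge0.
  move=> c cm; apply: le_tents; move: cm; rewrite !mem_filter => /andP[-> /=].
  rewrite !mem_pmap => /mapP[i]; rewrite mem_iota => /andP[_ im] ->.
  by apply/mapP; exists i => //; rewrite mem_iota/= (leq_trans im).
have lim_l x : (tents (l n) x)%:E @[n --> \oo] --> (f x)%:E.
  apply: cvg_EFin; first exact: nearW.
  apply/cvgrPdist_lt => e e0; have [c [cf' fc]] := tent_approx x cf f0 e0.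
  near=> n; rewrite /= ger0_norm ?subr_ge0//.
  suff : (tent c x <= tents (l n) x)%R by lra.
  apply: le_tents; rewrite mem_filter; apply/andP; split; first exact/asboolP.
  rewrite mem_pmap; apply/mapP; exists (pickle c); last by rewrite pickleK.
  by rewrite mem_iota/= add0n; near: n; exact: nbhs_infty_gt.
have mt n : measurable_fun setT (fun x : borelType X => (tents (l n) x)%:E).
  by apply/measurable_EFinP; exact: measurable_tents.
have cvg_int : \int[mu]_x (tents (l n) x)%:E @[n --> \oo] --> \int[mu]_x (f x)%:E.
  rewrite (eq_integral (fun x : borelType X => limn (fun n => (tents (l n) x)%:E))).
    apply: (@cvg_monotone_convergence _ _ _ mu setT) => //.
      by move=> n x _; rewrite lee_fin; exact: tents_ge0.
  by move=> x _; rewrite (cvg_lim _ (lim_l x)).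
have [n rn] : exists n, r < \int[mu]_x (tents (l n) x)%:E.
  apply: contrapT => /forallNP H; move: rf; rewrite ltNge => /negP; apply.
  rewrite -(cvg_lim _ cvg_int)//; apply: lime_le.
    by apply/cvg_ex; eexists; exact: cvg_int.
  by apply: nearW => n; rewrite leNgt; exact/negP.
by exists (l n).
Unshelve. all: by end_near. Qed.

(** The sets defined by finitely many lower bounds on the integrals of finite
    maxima of tents.  Their indices range over a countable type, and they form a
    base of the weak topology, which is therefore second countable. *)
Definition basic_open (cs : seq (seq (nat * rat * nat) * rat)) : set (weakP R X) :=
  [set nu : weakP R X | forall c, c \in cs ->
    (ratr c.2)%:E < \int[nu : prob]_x (tents c.1 x)%:E].

Definition basic_nbhs (mu : weakP R X) : set_system (weakP R X) :=
  [set A | exists2 cs, basic_open cs mu & basic_open cs `<=` A].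

Lemma basic_nbhs_filter mu : Filter (basic_nbhs mu).
Proof.
split; first by exists [::].
- move=> A B [cs csmu csA] [ds dsmu dsB]; exists (cs ++ ds) => [c|nu H].
    by rewrite mem_cat => /orP[/csmu|/dsmu].
  split; [apply: csA|apply: dsB] => c cc; apply: H; rewrite mem_cat cc//.
  by rewrite orbT.
- by move=> A B AB [cs csmu csA]; exists cs => //; exact: subset_trans AB.
Qed.

Lemma basic_nbhs_integral (f : X -> R) (mu : weakP R X) (M e : R) :
  continuous f -> (forall x, (0 <= f x <= M)%R) -> (0 < e)%R ->
  basic_nbhs mu [set nu : weakP R X |
    ((\int[mu : prob]_x f x) - e < \int[nu : prob]_x f x)%R].
Proof.
move=> cf f0M e0.
have f0 x : (0 <= f x)%R by case/andP: (f0M x).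
have mf : measurable_fun setT (fun x : borelType X => (f x)%:E).
  by apply/measurable_EFinP; exact: continuous_borel.
have fin (nu : prob) : \int[nu]_x (f x)%:E = (\int[nu]_x f x)%R%:E.
  rewrite /Rintegral fineK// ge0_fin_numE; last first.
    by apply: integral_ge0 => x _; rewrite lee_fin.
  apply: (@le_lt_trans _ _ (\int[nu]_x (cst M%:E x))); last first.
    by rewrite integral_cst// [X in M%:E * X]probability_setT mule1 ltry.
  by apply: ge0_le_integralT => x; rewrite lee_fin//; case/andP: (f0M x).
have [q] : exists q : rat, ratr q \in
    `]((\int[mu : prob]_x f x) - e)%R, (\int[mu : prob]_x f x)%R[%R.
  by apply: rat_in_itvoo; rewrite ltrBlDr ltrDl.
rewrite in_itv/= => /andP[q1 q2].
have [l [lf ql]] : exists l, (forall x, (tents l x <= f x)%R) /\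
    (ratr q)%:E < \int[mu : prob]_x (tents l x)%:E.
  by apply: tents_approx => //; rewrite fin lte_fin.
exists [:: (l, q)] => [c|nu]; first by rewrite inE => /eqP->.
move=> /(_ (l, q)); rewrite inE eqxx => /(_ isT) /= qnu.
apply: lt_trans q1 _; rewrite -lte_fin -fin (lt_le_trans qnu)//.
by apply: ge0_le_integralT => x; rewrite lee_fin//; exact: tents_ge0.
Qed.

Lemma Rintegral_affine (f : X -> R) (nu : prob) (s M : R) :
  continuous f -> (forall x, (`|f x| <= M)%R) ->
  (\int[nu]_x (s * f x + M))%R = (s * (\int[nu]_x f x) + M)%R.
Proof.
move=> cf fM.
have mf : measurable_fun setT (f : borelType X -> R) by exact: continuous_borel.
have intf : nu.-integrable setT (EFin \o (f : borelType X -> R)).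
  apply: (@le_integrable _ _ _ nu setT _ _ (EFin \o cst M)) => //.
  - exact/measurable_EFinP.
  - by move=> x _ /=; rewrite lee_fin (le_trans (fM x)) ?ler_norm.
  - exact: finite_measure_integrable_cst.
rewrite RintegralD//; last 2 first.
- exact: (integrableZl measurableT s intf).
- exact: (finite_measure_integrable_cst nu M measurableT).
rewrite RintegralZl// Rintegral_cst//.
by rewrite [X in fine X]probability_setT mulr1.
Qed.

(** Upper bounds on the integral of [f] come from lower bounds on the integral of
    [- f]; both functions become nonnegative after adding a bound [M]. *)
Lemma cvg_basic_nbhs (mu : weakP R X) (f : @Cb R X) :
  (\int[nu : prob]_x sval f x)%R @[nu --> basic_nbhs mu] -->
  (\int[mu : prob]_x sval f x)%R.
Proof.
have FF := basic_nbhs_filter mu.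
case: f => f [cf [M fM]] /=; apply/cvgrPdist_lt => e e0.
have bound (s : R) : (s == 1 \/ s == -1)%R -> forall x, (0 <= s * f x + M <= M + M)%R.
  move=> s1 x; have := fM x; rewrite ler_norml => /andP[].
  by case: s1 => /eqP->; rewrite ?mul1r ?mulN1r => ? ?; apply/andP; split; lra.
have csf (s : R) : continuous (fun x : X => s * f x + M)%R.
  move=> x; apply: cvgD; last exact: cvg_cst.
  by apply: cvgM; [exact: cvg_cst|exact: cf].
have := basic_nbhs_integral mu (csf 1%R) (bound 1%R (or_introl (eqxx _))) e0.
have := basic_nbhs_integral mu (csf (-1)%R) (bound (-1)%R (or_intror (eqxx _))) e0.
move=> H1 H2; near=> nu.
have : [set nu : weakP R X | ((\int[mu : prob]_x (-1 * f x + M)) - e <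
    \int[nu : prob]_x (-1 * f x + M))%R] nu by near: nu.
have : [set nu : weakP R X | ((\int[mu : prob]_x (1 * f x + M)) - e <
    \int[nu : prob]_x (1 * f x + M))%R] nu by near: nu.
rewrite /= !Rintegral_affine// ltr_norml; lra.
Unshelve. all: by end_near. Qed.

(** The weak topology is the coarsest one for which these integrals are
    continuous, and they converge along the filter of the basic sets. *)
Lemma open_basic (O : set (weakP R X)) (mu : weakP R X) : open O -> O mu ->
  exists2 cs, basic_open cs mu & basic_open cs `<=` O.
Proof.
move=> -[ O' oO' <-] Omu; have FF := basic_nbhs_filter mu.
have : (@Cb_integral R X @ basic_nbhs mu) --> @Cb_integral R X mu.
  apply/cvg_sup => f U [_ [[B oB <-] Bf BU]].
  have nB : nbhs ((\int[mu : prob]_x sval f x)%R : R) B by exact: open_nbhs_nbhs.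
  have HB : basic_nbhs mu [set nu : weakP R X | B (\int[nu : prob]_x sval f x)%R].
    exact: (@cvg_basic_nbhs mu f B nB).
  by apply: (@filterS _ _ FF _ _ _ HB) => nu Bnu; exact: BU.
by move=> /(_ O' (open_nbhs_nbhs (conj oO' Omu))).
Qed.

(** An open set is the union of the countably many basic sets that it contains,
    and the preimage of a basic set is a finite intersection of conditions on
    integrals. *)
Lemma measurable_random_probability d (T : measurableType d) (p : T -> weakP R X) :
  (forall f : X -> R, continuous f -> (forall x, (0 <= f x)%R) ->
    measurable_fun setT (fun t => \int[p t : prob]_x (f x)%:E)) ->
  measurable_fun setT (p : T -> borelType (weakP R X)).
Proof.
move=> mp.
apply: (@measurability _ _ T (borelType (weakP R X)) setT p (@open (weakP R X))) => //.
move=> _ [ O oO <-]; rewrite setTI.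
pose C := [set cs | basic_open cs `<=` O].
rewrite (_ : p @^-1` O = \bigcup_(cs in C) (p @^-1` basic_open cs)); last first.
  apply/seteqP; split => [t Ot|t [cs csO cst]]; last exact: csO.
  by have [cs csm csO] := open_basic oO Ot; exists cs.
rewrite bigcup_mkcond; apply: countable_bigcupT_measurable => // cs.
case: ifP => // _.
elim: cs => [|c cs IH].
  by rewrite (_ : _ @^-1` _ = setT)//; apply/seteqP; split.
rewrite (_ : _ @^-1` _ = (fun t => \int[p t : prob]_x (tents c.1 x)%:E) @^-1`
    `](ratr c.2)%:E, +oo[ `&` (p @^-1` basic_open cs)).
  apply: measurableI => //; rewrite -[X in measurable X]setTI.
  have mc : measurable_fun setT (fun t => \int[p t : prob]_x (tents c.1 x)%:E).
    by apply: mp; [exact: continuous_tents|exact: tents_ge0].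
  by apply: mc => //; exact: emeasurable_itv.
apply/seteqP; split => [t H|t [/= H1 H2] b]; last first.
  rewrite inE => /predU1P[->|]; last exact: H2.
  by move: H1; rewrite in_itv/= andbT.
split => /=; first by rewrite in_itv/= andbT; apply: H; rewrite mem_head.
by move=> b bcs; apply: H; rewrite inE bcs orbT.
Qed.

End second_countable.

(** * The law of the Dirichlet process *)

Section negligible_difference.
Context d (T : measurableType d) (R : realType) (P : probability T R).

Lemma measure_ae_eq (A B : set T) : measurable A -> measurable B ->
  {ae P, forall x, A x <-> B x} -> P A = P B.
Proof.
move=> mA mB [N [mN N0 ABN]].
have le (C D : set T) : measurable C -> measurable D -> C `<=` D `|` N -> P C <= P D.
  move=> mC mD CD; apply: (@le_trans _ _ (P (D `|` N))).
    by apply: le_measure; rewrite ?inE//; exact: measurableU.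
  by rewrite -[leRHS]adde0 -N0; exact: measureU2.
apply/eqP; rewrite eq_le; apply/andP; split; apply: le => // x.
  move=> Ax; have [[AB _]|nAB] := pselect (A x <-> B x); first by left; exact: AB.
  by right; exact: ABN.
move=> Bx; have [[_ BA]|nAB] := pselect (A x <-> B x); first by left; exact: BA.
by right; exact: ABN.
Qed.

End negligible_difference.

Section canonical.
Context (R : realType) (X : completeMetricType R) (sepX : separable X).
Variables (alpha : R) (alpha_gt0 : (0 < alpha)%R).
Local Notation prob := (probability (borelType X) R).
Local Notation sticks := (seqspace R).

Section stick_breaking_measure.
Context d (T : measurableType d) (h : T -> borelType X).
Hypothesis mh : measurable_fun setT h.

(** The map [h] sends the atoms to the space: the identity gives the Dirichlet
    process itself, and the two projections of a product give two Dirichlet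
    processes with common sticks. *)
Definition stick_measure (zv : seqspace T * sticks) : weakP R X :=
  mixture (stick_weights zv.2) (fun i => h (zv.1 i)) : prob.

Lemma measurable_stick_series (u : T -> \bar R) : measurable_fun setT u ->
  (forall x, 0 <= u x) ->
  measurable_fun setT (fun zv : seqspace T * sticks =>
    \sum_(0 <= i <oo) (stick_weights zv.2 i)%:E * u (zv.1 i)).
Proof.
move=> mu u0; apply: ge0_emeasurable_sum => [i zv _ _|i _].
  by rewrite mule_ge0// lee_fin wt_ge0.
apply: emeasurable_funM.
  apply/measurable_EFinP.
  have mw := @measurable_stick_weights R i.
  exact: (measurableT_comp mw measurable_snd).
apply: measurableT_comp mu _.
exact: measurableT_comp (measurable_coord i) measurable_fst.
Qed.

Lemma measurable_stick_measure :
  measurable_fun setT (stick_measure : _ -> borelType (weakP R X)).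
Proof.
have [a da] := dense_sequence sepX.
apply: (measurable_random_probability da) => f cf f0.
have mf : measurable_fun setT (fun x : borelType X => (f x)%:E).
  by apply/measurable_EFinP; exact: continuous_borel.
rewrite (_ : (fun zv => _) = (fun zv : seqspace T * sticks =>
    \sum_(0 <= i <oo) (stick_weights zv.2 i)%:E * (f (h (zv.1 i)))%:E)).
  apply: (@measurable_stick_series (fun t => (f (h t))%:E)).
    exact: measurableT_comp mf mh.
  by move=> t; rewrite lee_fin.
by apply/funext => zv; rewrite integral_mixture// => x; rewrite lee_fin.
Qed.

Variables (mu : probability T R).

Definition stick_space : probability (seqspace T * sticks)%type R :=
  (iid_prob mu \x iid_prob (stick_prob alpha_gt0)).

Lemma stick_spaceE A B : measurable A -> measurable B ->
  stick_space (A `*` B) = iid_prob mu A * iid_prob (stick_prob alpha_gt0) B.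
Proof. exact: product_measure1E. Qed.

(** Integrate first over the atoms: each term has mean [w i * int u dmu], and the
    weights sum to 1. *)
Lemma expected_stick_series (u : T -> \bar R) : measurable_fun setT u ->
  (forall x, 0 <= u x) ->
  \int[stick_space]_zv (\sum_(0 <= i <oo) (stick_weights zv.2 i)%:E * u (zv.1 i))
  = \int[mu]_x u x.
Proof.
move=> mu' u0.
have coordE i : \int[iid_prob mu]_z u (z i) = \int[mu]_x u x.
  transitivity (\int[law (iid_prob mu) (measurable_coord i)]_x u x).
    by rewrite ge0_integral_pushforward//; exact: measurable_coord.
  apply: eq_measure_integral => A mA _; rewrite [LHS]lawE.
  have := iid_prob_cap mu (s := [:: i]) (B := fun=> A) isT (fun=> mA).
  rewrite big_seq1; apply: etrans; congr (iid_prob mu _).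
  apply/seteqP; split => w /=; first by move=> wA j; rewrite /= inE => /eqP->.
  by move=> /(_ i); rewrite /= inE eqxx; apply.
rewrite fubini_tonelli2//; last 2 first.
- exact: measurable_stick_series.
- by move=> zv; apply: nneseries_ge0 => i _ _; rewrite mule_ge0// lee_fin wt_ge0.
transitivity (\int[iid_prob (stick_prob alpha_gt0)]_v (\int[mu]_x u x)).
  apply: eq_integral => v _; rewrite /fubini_G.
  change (\int[iid_prob mu]_z (\sum_(0 <= i <oo) (stick_weights v i)%:E * u (z i)) =
    \int[mu]_x u x).
  rewrite integral_nneseries//; last 2 first.
  - move=> i; apply: emeasurable_funM; first exact: measurable_cst.
    exact: measurableT_comp mu' (measurable_coord i).
  - by move=> i z _; rewrite mule_ge0// lee_fin wt_ge0.
  under eq_eseriesr => i _.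
    rewrite ge0_integralZl//; last 2 first.
    - exact: measurableT_comp mu' (measurable_coord i).
    - by rewrite lee_fin wt_ge0.
    rewrite coordE.
    over.
  (* The sum of the weights times a constant, read as the integral of the
     constant against a mixture. *)
  transitivity (\int[mixture (stick_weights v) (fun=> point : T)]_y
      cst (\int[mu]_x u x) y).
    by rewrite integral_mixture// => x; exact: integral_ge0.
  by rewrite integral_cst// [X in _ * X]probability_setT mule1.
by rewrite integral_cst// [X in _ * X]probability_setT mule1.
Qed.

(** The mean of a Dirichlet process is its base measure, here the image of [mu]
    under [h]. *)
Lemma expected_stick_measure (P : prob) (f : X -> R) :
  (forall A, measurable A -> law mu mh A = P A) ->
  continuous f -> (forall x, (0 <= f x)%R) ->
  \int[stick_space]_zv (\int[stick_measure zv : prob]_x (f x)%:E) =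
  \int[P]_x (f x)%:E.
Proof.
move=> muP cf f0.
have mf : measurable_fun setT (fun x : borelType X => (f x)%:E).
  by apply/measurable_EFinP; exact: continuous_borel.
have f0E (x : borelType X) : 0 <= (f x)%:E by rewrite lee_fin.
under eq_integral do rewrite integral_mixture//.
rewrite (@expected_stick_series (fun t => (f (h t))%:E))//; last first.
  exact: measurableT_comp mf mh.
transitivity (\int[law mu mh]_x (f x)%:E).
  by rewrite ge0_integral_pushforward.
by apply: eq_measure_integral => A mA _; exact: muP.
Qed.

Definition stick_breaking_law : probability (borelType (weakP R X)) R :=
  law stick_space measurable_stick_measure.

Let fstX (zv : seqspace T * sticks) i : borelType X := h (zv.1 i).
Let sndV (zv : seqspace T * sticks) i : R := zv.2 i.

Let mfstX i : measurable_fun setT (fun zv => fstX zv i).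
Proof.
apply: measurableT_comp mh _.
exact: measurableT_comp (measurable_coord i) measurable_fst.
Qed.

Let msndV i : measurable_fun setT (fun zv => sndV zv i).
Proof. exact: measurableT_comp (measurable_coord i) measurable_snd. Qed.

Let Z i : {RV stick_space >-> borelType X} := mfun_Sub (mem_set (mfstX i)).
Let V i : {RV stick_space >-> R} := mfun_Sub (mem_set (msndV i)).
Let p : {RV stick_space >-> borelType (weakP R X)} :=
  mfun_Sub (mem_set measurable_stick_measure).

Let mhA A : measurable A -> measurable (h @^-1` A).
Proof. by move=> mA; rewrite -[X in measurable X]setTI; exact: mh. Qed.

Let ZE (s : seq nat) (B : nat -> set (borelType X)) :
  uniq s -> (forall i, measurable (B i)) ->
  stick_space (\bigcap_(i in [set` s]) (Z i @^-1` B i)) =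
  \prod_(i <- s) mu (h @^-1` B i).
Proof.
move=> us mB; rewrite -(iid_prob_cap mu us (B := fun i => h @^-1` B i)); last first.
  by move=> i; exact: mhA.
rewrite (_ : \bigcap_(i in _) (Z i @^-1` B i) =
    (\bigcap_(i in [set` s]) ((fun w : seqspace T => w i) @^-1` (h @^-1` B i))) `*` setT).
  rewrite stick_spaceE//; first by rewrite [X in _ * X]probability_setT mule1.
  apply: bigcap_measurableType => i _; rewrite -[X in measurable X]setTI.
  by apply: measurable_coord => //; exact: mhA.
apply/seteqP; split => [[z v]|[z v]] /= H; first by split => // i /H.
by move=> i /H.1.
Qed.

Let VE (s : seq nat) (B : nat -> set R) :
  uniq s -> (forall i, measurable (B i)) ->
  stick_space (\bigcap_(i in [set` s]) (V i @^-1` B i)) =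
  \prod_(i <- s) beta_law 1 alpha (B i).
Proof.
move=> us mB; transitivity (\prod_(i <- s) stick_prob alpha_gt0 (B i)) => //.
rewrite -(iid_prob_cap _ us)//.
rewrite (_ : \bigcap_(i in _) (V i @^-1` B i) =
    setT `*` (\bigcap_(i in [set` s]) ((fun w : sticks => w i) @^-1` (B i)))).
  rewrite stick_spaceE//; first by rewrite [X in X * _]probability_setT mul1e.
  apply: bigcap_measurableType => i _; rewrite -[X in measurable X]setTI.
  by apply: measurable_coord => //; exact: mB.
apply/seteqP; split => [[z v]|[z v]] /= H; first by split => // i /H.
by move=> i /H.2.
Qed.

Let iid_intro d' (S : measurableType d') (U : nat -> {RV stick_space >-> S})
    (nu : set S -> \bar R) :
  (forall (s : seq nat) (B : nat -> set S), uniq s -> (forall i, measurable (B i)) ->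
    stick_space (\bigcap_(i in [set` s]) (U i @^-1` B i)) = \prod_(i <- s) nu (B i)) ->
  iid U nu.
Proof.
move=> H; have marg i A : measurable A -> distribution stick_space (U i) A = nu A.
  move=> mA; have := H [:: i] (fun=> A) isT (fun=> mA); rewrite big_seq1.
  apply: etrans; congr (stick_space _); apply/seteqP; split => w /=.
    by move=> wA j; rewrite /= inE => /eqP->.
  by move=> /(_ i); rewrite /= inE eqxx; apply.
split => // s B us mB; rewrite H//; apply: eq_bigr => i _.
by rewrite -(marg i).
Qed.

Let independentZV : independent_seqs Z V.
Proof.
move=> _ _ /sigma_seqE[A mA ->] /sigma_seqE[B mB ->].
pose A' : set (seqspace T) := (fun z i => h (z i)) @^-1` A.
have mA' : measurable A'.
  rewrite -[X in measurable X]setTI.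
  have mc : measurable_fun setT
      (fun z : seqspace T => (fun i => h (z i)) : seqspace (borelType X)).
    by apply: measurable_seqP => i; exact: measurableT_comp mh (measurable_coord i).
  exact: mc.
rewrite (_ : seqRV Z @^-1` A = A' `*` setT); last first.
  by apply/seteqP; split => [[z v]|[z v] []].
rewrite (_ : seqRV V @^-1` B = setT `*` B); last first.
  by apply/seteqP; split => [[z v]|[z v] []].
rewrite -setXI setIT setTI !stick_spaceE//.
by rewrite [X in _ * X * _]probability_setT [X in _ = _ * (X * _)]probability_setT
  mule1 mul1e.
Qed.

Lemma is_DP_stick_breaking (P : prob) : (forall A, measurable A -> law mu mh A = P A) ->
  is_DP alpha P stick_breaking_law.
Proof.
move=> muP; exists _, _, stick_space, Z, V, p; split => //.
- apply: iid_intro => s B us mB; rewrite ZE//; apply: eq_bigr => i _.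
  by rewrite -muP.
- exact: iid_intro VE.
- have [N [mN N0 NP]] := proper_sticks_ae alpha_gt0.
  exists (setT `*` N); split.
  + exact: measurableX.
  + by rewrite stick_spaceE// N0 mule0.
  + move=> [z v] /= H; split => //; apply: NP => pv; apply: H => A mA.
    apply: eq_eseriesr => i _; congr (_%:E * _).
    exact: stick_weightsE.
Qed.

End stick_breaking_measure.

Definition DP_canonical (P : prob) : probability (borelType (weakP R X)) R :=
  stick_breaking_law (@measurable_id _ (borelType X) setT) P.

(** In any realization the sequences of atoms and of sticks are independent with
    product laws, so their joint law is the one of [stick_space].  The random
    probability equals the stick-breaking sum off a null set, and there it lies
    in the same Borel sets. *)
Lemma is_DP_unique (P : prob) Q : is_DP alpha P Q ->
  forall B, measurable B -> Q B = DP_canonical P B.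
Proof.
move=> [d [Om [Pr [Z [V [p [iZ iV ind pE QE]]]]]]] B mB.
pose phi (w : Om) : seqspace (borelType X) * sticks := (seqRV Z w, seqRV V w).
have mphi : measurable_fun setT phi.
  by apply: measurable_fun_pair; exact: measurable_seqRV.
have lawphi A : measurable A -> stick_space P A = law Pr mphi A.
  apply: product_measure_unique => C D mC mD.
  rewrite [LHS]lawE (_ : _ @^-1` _ = (seqRV Z @^-1` C) `&` (seqRV V @^-1` D)).
    rewrite ind; [|exact: sigma_seq_preimage..].
    congr (_ * _); first exact: (law_seqRV iZ).
    exact: (@law_seqRV _ _ _ _ _ _ _ (stick_prob alpha_gt0) iV).
  by apply/seteqP; split.
pose S := @stick_measure _ (borelType X) id.
have mS := measurable_stick_measure (@measurable_id _ (borelType X) setT).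
rewrite QE// [RHS]lawE lawphi; last by rewrite -[X in measurable X]setTI; exact: mS.
rewrite lawE; apply: (@measure_ae_eq _ _ _ Pr (p @^-1` B) (phi @^-1` (S @^-1` B))).
- exact: (measurable_funPTI p mB).
- have mSphi := measurableT_comp mS mphi.
  by rewrite -[X in measurable X]setTI; exact: mSphi.
have [N [mN N0 NP]] := proper_sticks_ae alpha_gt0.
have : Pr.-negligible (seqRV V @^-1` N).
  exists (seqRV V @^-1` N); split => //.
    by rewrite -[X in measurable X]setTI; exact: measurable_seqRV.
  rewrite -N0; symmetry.
  by rewrite -(@law_seqRV _ _ _ _ _ _ _ (stick_prob alpha_gt0) iV).
move: pE => /negligibleU/[apply]; apply: negligibleS => w /= nB.
apply: contrapT => /not_orP[/contrapT pw nN]; apply: nB.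
suff -> : B (p w) = B (S (phi w)) by [].
apply: weakP_indistinguishable => // A mA; rewrite pw//.
transitivity (mixture (stick_weights (seqRV V w)) (fun i => Z i w) A) => //.
rewrite mixtureE; apply: eq_eseriesr => i _; congr (_%:E * _); symmetry.
by apply: stick_weightsE; apply: contrapT => npv; apply: nN; exact: NP.
Qed.

(** The Dirichlet process may be built from atoms on any space that carries a
    variable of law [P]. *)
Lemma DP_stick_breaking d (T : measurableType d) (h : T -> borelType X)
    (mh : measurable_fun setT h) (mu : probability T R) (P : prob) :
  (forall A, measurable A -> law mu mh A = P A) ->
  forall B, measurable B -> DP alpha P B = stick_breaking_law mh mu B.
Proof.
move=> muP B mB; rewrite (is_DP_unique (is_DP_stick_breaking muP))//.
apply: is_DP_unique => //; apply: getPex; exists (stick_breaking_law mh mu).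
exact: is_DP_stick_breaking.
Qed.

End canonical.

(** * The two inequalities *)

Section pushforward_bound.
Context d d' (T : measurableType d) (T' : measurableType d') (R : realType).
Variables (P : probability T R) (f : T -> T').
Hypothesis mf : measurable_fun setT f.
Import HBNNSimple.

(** A simple function below [c] pulls back to a simple function below [e].  This
    is how the cost [W], possibly nonmeasurable, is handled. *)
Lemma integral_law_le (c : T' -> \bar R) (e : T -> \bar R) :
  (forall y, 0 <= c y) -> (forall x, c (f x) <= e x) ->
  \int[law P mf]_y c y <= \int[P]_x e x.
Proof.
move=> c0 ce; rewrite ge0_integralTE//; apply: ge_ereal_sup => _ [g gc <-].
rewrite -integralT_nnsfun ge0_integral_pushforward//=; last 2 first.
- by apply/measurable_EFinP; exact: measurable_funP.
- by move=> y _; rewrite lee_fin.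
apply: ge0_le_integralT => x /=; first by rewrite lee_fin.
exact: le_trans (gc _) (ce x).
Qed.

End pushforward_bound.

Section main.
Context (R : realType) (X : completeMetricType R).
Hypothesis sepX : separable X.
Variables (alpha : R) (alpha_gt0 : (0 < alpha)%R).
Local Notation prob := (probability (borelType X) R).

Lemma W_ge0 (P Q : prob) : 0 <= W P Q.
Proof. by apply: transport_cost_ge0 => x y; rewrite lee_fin mdist_ge0. Qed.

(** The mixture of the pairs is a coupling of the two mixtures. *)
Lemma W_mixture (w : weights R) (z : nat -> borelType X * borelType X) :
  W (mixture w (fst \o z) : prob) (mixture w (snd \o z)) <=
  \sum_(0 <= i <oo) (w i)%:E * (mdist ((z i).1 : X) (z i).2)%:E.
Proof.
have md : measurable_fun setT (fun u : borelType X * borelType X =>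
    (mdist (u.1 : X) u.2)%:E) by apply/measurable_EFinP; exact: measurable_mdist.
rewrite -(integral_mixture w z md); last by move=> u; rewrite lee_fin mdist_ge0.
apply: ereal_inf_lbound; exists (mixture w z) => //; split => A mA.
  apply: eq_eseriesr => i _; congr (_ * _).
  rewrite /= !diracE; congr (_%:R)%:E; congr nat_of_bool.
  by apply/idP/idP; rewrite !inE/=; [case|].
apply: eq_eseriesr => i _; congr (_ * _).
rewrite /= !diracE; congr (_%:R)%:E; congr nat_of_bool.
by apply/idP/idP; rewrite !inE/=; [case|].
Qed.

(** With pairs drawn from a coupling [g] and common sticks, the two
    stick-breaking measures are coupled at a mean cost bounded by that of [g]. *)
Lemma WW_le_W (P1 P2 : prob) : WW (DP alpha P1) (DP alpha P2) <= W P1 P2.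
Proof.
apply: le_ereal_inf_tmp => _ [g cg <-].
have mg1 A : measurable A -> law g measurable_fst A = P1 A.
  move=> mA; rewrite -cg.1// [LHS]lawE; congr (g _).
  by apply/seteqP; split => // -[x y] [].
have mg2 A : measurable A -> law g measurable_snd A = P2 A.
  move=> mA; rewrite -cg.2// [LHS]lawE; congr (g _).
  by apply/seteqP; split => // -[x y] [].
have m1 := measurable_stick_measure sepX (@measurable_fst _ _ (borelType X) (borelType X)).
have m2 := measurable_stick_measure sepX (@measurable_snd _ _ (borelType X) (borelType X)).
have m12 := measurable_fun_pair m1 m2.
pose Om := stick_space alpha_gt0 g.
apply: (@le_trans _ _ (\int[law Om m12]_z @W R X z.1 z.2)).
  apply: ereal_inf_lbound; exists (law Om m12) => //; split => A mA.
    rewrite (DP_stick_breaking sepX alpha_gt0 mg1 mA).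
    rewrite [LHS]lawE; congr (Om _); by apply/seteqP; split => // zv [].
  rewrite (DP_stick_breaking sepX alpha_gt0 mg2 mA).
  rewrite [LHS]lawE; congr (Om _); by apply/seteqP; split => // zv [].
have md : measurable_fun setT (fun u : borelType X * borelType X =>
    (mdist (u.1 : X) u.2)%:E) by apply/measurable_EFinP; exact: measurable_mdist.
rewrite -(expected_stick_series alpha_gt0 g md); last by move=> u; rewrite lee_fin mdist_ge0.
apply: integral_law_le => [z|zv]; first exact: W_ge0.
exact: W_mixture.
Qed.

Variables (f : X -> R) (M : R).
Hypotheses (f_ge0 : forall x, (0 <= f x)%R) (f_le : forall x, (f x <= M)%R)
  (f_lip : forall x y, (f x <= mdist x y + f y)%R).

Let cf : continuous f. Proof. exact: lipschitz_continuous. Qed.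

Let mf : measurable_fun setT (f : borelType X -> R).
Proof. exact: continuous_borel. Qed.

Definition potential (p : weakP R X) : R := (\int[p : prob]_x f x)%R.

Lemma potentialE (p : prob) : (potential p)%:E = \int[p]_x (f x)%:E.
Proof.
rewrite /potential /Rintegral fineK// ge0_fin_numE; last first.
  by apply: integral_ge0 => x _; rewrite lee_fin.
apply: (@le_lt_trans _ _ (\int[p]_x (cst M%:E x))); last first.
  by rewrite integral_cst// [X in M%:E * X]probability_setT mule1 ltry.
by apply: ge0_le_integralT => x; rewrite lee_fin.
Qed.

Lemma potential_ge0 p : (0 <= potential p)%R.
Proof. by rewrite -lee_fin potentialE; apply: integral_ge0 => x _; rewrite lee_fin. Qed.

(** The map [potential] is one of the coordinates that define the weak topology,
    as [f] is bounded and continuous. *)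
Lemma continuous_potential : continuous potential.
Proof.
have fb : continuous f /\ exists M, forall x, (`|f x| <= M)%R.
  by split => //; exists M => x; rewrite ger0_norm.
pose F : @Cb R X := exist _ f fb; pose K (_ : @Cb R X) : topologicalType := R.
apply/continuousP => B oB.
exists ((fun g : prod_topology K => g F) @^-1` B) => //.
apply: (@open_comp (prod_topology K) R) => // g _ U gU.
have sub := (@cvg_sup _ _ _ (nbhs (g : prod_topology K)) g _).1 (@cvg_id _ _) F.
by apply: sub; exact: initial_continuous gU.
Qed.

Lemma potential_lip (p q : prob) : (potential p)%:E <= W p q + (potential q)%:E.
Proof.
rewrite !potentialE; apply: transport_cost_ge => // x y.
by rewrite lee_fin mdist_ge0.
Qed.

Lemma integral_potential (P : prob) :
  \int[DP alpha P]_p (potential p)%:E = \int[P]_x (f x)%:E.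
Proof.
have mphi : measurable_fun setT (fun p : borelType (weakP R X) => (potential p)%:E).
  by apply/measurable_EFinP; apply: continuous_borel; exact: continuous_potential.
have Pid A : measurable A -> law P (@measurable_id _ (borelType X) setT) A = P A by [].
rewrite -(expected_stick_measure alpha_gt0 Pid cf f_ge0).
transitivity (\int[stick_breaking_law sepX alpha_gt0 (@measurable_id _ (borelType X) setT) P]_p
    (potential p)%:E).
  apply: eq_measure_integral => A mA _.
  exact: (DP_stick_breaking sepX alpha_gt0 Pid mA).
rewrite ge0_integral_pushforward//; last first.
  by move=> p _; rewrite lee_fin potential_ge0.
by apply: eq_integral => zv _ /=; rewrite potentialE.
Qed.

Lemma WW_ge_potential (P1 P2 : prob) :
  \int[P1]_x (f x)%:E <= WW (DP alpha P1) (DP alpha P2) + \int[P2]_x (f x)%:E.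
Proof.
rewrite -!integral_potential; apply: transport_cost_ge.
- by apply: continuous_borel; exact: continuous_potential.
- exact: potential_ge0.
- by move=> p q; exact: W_ge0.
- exact: potential_lip.
Qed.

End main.

Local Close Scope ereal_scope.

Theorem corollary3p7 (R : realType) (X : completeMetricType R)
    (sepX : separable X) (bdX : bounded_diameter X)
    (P1 P2 : probability (borelType X) R) (alpha : R) (alpha_gt0 : 0 < alpha) :
  WW (DP alpha P1) (DP alpha P2) = W P1 P2.
Proof.
apply/eqP; rewrite eq_le WW_le_W//=; apply/lee_addgt0Pr => e e0.
have [f [f0 [M fM] flip Wf]] := kantorovich sepX bdX P1 P2 e0.
have WWf := WW_ge_potential sepX alpha_gt0 f0 fM flip P1 P2.
have ffin : (\int[P2]_x (f x)%:E)%E \is a fin_num by rewrite -(potentialE f0 fM).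
rewrite -(leeD2rE _ _ ffin).
by apply: (le_trans Wf); rewrite [leRHS]addeAC; exact: leeD2r.
Qed.
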